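(* For $0\le\alpha<1$ and $\theta\ge0$, let $(\mathcal C_n)$ be the regenerative composition structure with Laplace exponent $$\Phi(s)=s\,\mathrm B(1-\alpha,s+\theta),\qquad s>0.$$ Then the distribution of the exchangeable random partition $\Pi_n$ of $[n]$ derived from $(\mathcal C_n)$ is that of an $(\alpha,\theta)$-partition: for each particular partition $\pi$ of $[n]$ into $k$ classes of sizes $n_1,\dots,n_k$, $$\mathbb P(\Pi_n=\pi)=\frac{\prod_{i=1}^{k-1}(\theta+\alpha i)}{[1+\theta]_{n-1}}\prod_{i=1}^k[1-\alpha]_{n_i-1}.\qquad( * )$$ For other values of $(\alpha,\theta)$, besides the limiting case $(1,\theta)$ for $\theta\ge0$, which generates the pure singleton partition, there is no regenerative composition structure which generates an $(\alpha,\theta)$-partition structure.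
   Context: A composition of $n$ is a sequence of positive integers (its parts) with sum $n$. A composition structure $(\mathcal C_n)_{n\ge1}$ is a Markovian sequence of random compositions $\mathcal C_n$ of $n$ such that, if $n$ identical balls are distributed into an ordered series of boxes according to $\mathcal C_n$, then $\mathcal C_{n-1}$ is obtained by discarding one of the balls picked uniformly at random and then deleting an empty box in case one is created. It is regenerative if for all $n>m\ge1$, given that the first part of $\mathcal C_n$ is $m$, the remaining composition of $n-m$ is distributed like $\mathcal C_{n-m}$. The regenerative composition structure with Laplace exponent $\Phi$ (with $\Phi(0)=0$) is the one with $\mathbb P(\mathcal C_n=(n_1,\dots,n_k))=\prod_{j=1}^k q(N_j:n_j)$, $N_j=n_j+\dots+n_k$, where $q(n:m)=\Phi(n:m)/\Phi(n)$ and $\Phi(n:m)=\binom nm\sum_{j=0}^m(-1)^{j+1}\binom mj\Phi(n-m+j)$. (Equivalently, it is derived from a subordinator with Laplace exponent $\Phi$ by separating independent standard exponential sample points into clusters by the closed range of the subordinator, independent of the sample, and recording the cluster sizes from left to right.) Derived partitions: given $\mathcal C_n$ with parts viewed as $n$ balls in an ordered series of boxes, label the balls by an independent uniform random permutation of $[n]=\{1,\dots,n\}$. This gives a random exchangeable ordered partition $\mathcal C_n^*$ of $[n]$, and $\Pi_n$ is the partition of $[n]$ obtained by ignoring the order of classes. Thus, if $p$ is the composition probability function $p(\lambda)=\mathbb P(\mathcal C_n=\lambda)$, then for a partition $\pi$ with class sizes $n_1,\dots,n_k$, $\mathbb P(\Pi_n=\pi)=\binom{n}{n_1,\dots,n_k}^{-1}\sum_\sigma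 p(n_{\sigma(1)},\dots,n_{\sigma(k)})$, the sum being over all $k!$ permutations $\sigma$ of $\{1,\dots,k\}$. The $(\alpha,\theta)$-partition structure is the partition structure determined by $( * )$ for all $n$ and $\pi$, for those values of $(\alpha,\theta)$ for which $( * )$ defines a partition structure; this is so for $0\le\alpha<1$ and $\theta\ge0$, and also for some $(\alpha,\theta)$ with either $\alpha<0$ or $\theta<0$. A composition structure generates the $(\alpha,\theta)$-partition structure if its derived partitions $\Pi_n$ satisfy $( * )$ for all $n$ and $\pi$. The pure singleton partition is the one all of whose classes are singletons. Notation: $\mathrm B(a,b)=\Gamma(a)\Gamma(b)/\Gamma(a+b)$; $[x]_n=x(x+1)\cdots(x+n-1)$, $[x]_0=1$.
   Formalization: The non-existence claim excludes θ = −α and (α = 1, θ < 0): there ( * ), where defined, is the one-class partition, generated by C_n = (n), or the pure singleton partition, generated by (1,…,1), both regenerative, so the claim as stated fails. *)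

(* Defs.v *)
From HB Require Import structures.
From mathcomp Require Import all_boot all_order all_algebra all_fingroup.
From mathcomp Require Import all_classical all_reals all_analysis.

Set Implicit Arguments.
Unset Strict Implicit.
Unset Printing Implicit Defensive.

Import Order.TTheory GRing.Theory Num.Theory.
Import numFieldNormedType.Exports.

Local Open Scope ring_scope.
Local Open Scope set_scope.

(** ** Compositions *)

Definition is_composition (n : nat) (l : seq nat) : bool :=
  all (leq 1%N) l && (sumn l == n).

(* A composition of n has at most n parts, each at most n, so it occurs among
   the sequences of length at most n over 'I_n.+1. *)
Definition compositions (n : nat) : seq (seq nat) :=
  [seq l <- [seq [seq nat_of_ord i | i <- c] | c : n.-bseq 'I_n.+1]
         | is_composition n l].

Lemma compositions_uniq n : uniq (compositions n).
Proof.
rewrite filter_uniq // map_inj_uniq ?enum_uniq // => c d.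
by move/(inj_map val_inj)/val_inj.
Qed.

Lemma mem_compositions n l : (l \in compositions n) = is_composition n l.
Proof.
rewrite mem_filter andb_idr // => /andP[/allP pos_l /eqP sum_l].
have size_l : (size l <= n)%N.
  rewrite -sum_l; elim: l pos_l {sum_l} => //= m l IHl pos_ml.
  rewrite -add1n leq_add ?IHl ?pos_ml ?mem_head // => k lk.
  by apply: pos_ml; rewrite inE lk orbT.
have le_l k : k \in l -> (k <= n)%N.
  rewrite -sum_l; elim: l {pos_l sum_l size_l} => //= m l IHl.
  rewrite inE => /predU1P[->|/IHl le_kl]; first exact: leq_addr.
  exact: leq_trans le_kl (leq_addl _ _).
have size_c : (size [seq inord k : 'I_n.+1 | k <- l] <= n)%N by rewrite size_map.
apply/mapP; exists (Bseq size_c); first by rewrite mem_enum.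
rewrite /= -map_comp map_id_in // => k lk /=.
by rewrite inordK // ltnS le_l.
Qed.

(* The n balls are 'I_n, placed in the boxes from left to right: ball i lies in
   box number [box l i], the first box taking the balls 0, ..., l_0 - 1. *)
Definition box (l : seq nat) (i : nat) : nat := reshape_index l i.

Definition discard (l : seq nat) (b : nat) : seq nat :=
  [seq m <- set_nth 0%N l b (nth 0%N l b).-1 | m != 0%N].

(** ** Composition structures

A sequence of random compositions enters only through its composition
probability function: [p l] stands for P(C_n = l) with n = sumn l.  The backward
transition from C_(n+1) to C_n being prescribed, these laws determine the law
of the Markovian sequence, and they come from one exactly when
[composition_structure] holds.  Values of [p] at sequences that are not
compositions of some n >= 1 are irrelevant. *)
Section Structures.
Variable R : realType.
Implicit Types (p : seq nat -> R) (Phi : R -> R).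

Definition composition_structure p : Prop :=
  (forall n l, (0 < n)%N -> is_composition n l -> 0 <= p l) /\
  (forall n, (0 < n)%N -> \sum_(l <- compositions n) p l = 1) /\
  (forall n l, (0 < n)%N -> is_composition n l ->
     p l = \sum_(k <- compositions n.+1)
             p k * (#|[set i : 'I_n.+1 | discard k (box k i) == l]|%:R
                     / n.+1%:R)).

Definition first_part p (n m : nat) : R :=
  \sum_(l <- compositions n | head 0%N l == m) p l.

Definition regenerative p : Prop :=
  forall n m l, (0 < m < n)%N -> is_composition (n - m) l ->
    first_part p n m != 0 -> p (m :: l) / first_part p n m = p l.

Definition regenerative_composition_structure p : Prop :=
  composition_structure p /\ regenerative p.

Definition Phi_binom Phi (n m : nat) : R :=
  'C(n, m)%:R *
  \sum_(j < m.+1) (-1) ^+ j.+1 * 'C(m, j)%:R * Phi (n - m + j)%:R.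

Definition decrement Phi (n m : nat) : R := Phi_binom Phi n m / Phi n%:R.

Definition laplace_cpf Phi (l : seq nat) : R :=
  \prod_(j < size l) decrement Phi (sumn (drop j l)) (nth 0%N l j).

(** ** Derived partitions *)

(* Ball i receives the label s i; the classes are the sets of labels found in
   the same box. *)
Definition labelled_partition (n : nat) (l : seq nat) (s : 'S_n)
    : {set {set 'I_n}} :=
  preim_partition (fun x : 'I_n => box l ((s^-1)%g x)) [set: 'I_n].

Definition derived_law p (n : nat) (P : {set {set 'I_n}}) : R :=
  \sum_(l <- compositions n)
     p l * (#|[set s : 'S_n | labelled_partition l s == P]|%:R / n`!%:R).

Definition rising (x : R) (n : nat) : R := \prod_(i < n) (x + i%:R).

Definition two_parameter_law (alpha theta : R) (n : nat)
    (P : {set {set 'I_n}}) : R :=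
  (\prod_(1 <= i < #|P|) (theta + alpha * i%:R)) / rising (1 + theta) n.-1
  * \prod_(B in P) rising (1 - alpha) #|B|.-1.

(* When theta is a negative integer the formula divides by 0, so it defines no
   partition structure; the right-hand side is then 0 for large n, and no p
   whose laws have total mass 1 satisfies this. *)
Definition generates p (alpha theta : R) : Prop :=
  forall n (P : {set {set 'I_n}}), (0 < n)%N -> finset.partition P [set: 'I_n] ->
    derived_law p P = two_parameter_law alpha theta P.

Definition generates_singletons p : Prop :=
  forall n (P : {set {set 'I_n}}), (0 < n)%N -> finset.partition P [set: 'I_n] ->
    derived_law p P = [forall B in P, #|B| == 1%N]%:R.

(* Parameters at which the two-parameter formula, where it is defined, only
   repeats the structure of another parameter pair: the single-class partition
   of (0, 0) when theta = - alpha, the pure singleton partition of (1, 0) when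
   alpha = 1. *)
Definition degenerate (alpha theta : R) : Prop :=
  theta = - alpha \/ (alpha = 1 /\ theta < 0).

(** ** The Laplace exponent *)

Definition Gamma (a : R) : R :=
  \int[lebesgue_measure]_(t in `]0, +oo[) (t `^ (a - 1) * expR (- t)).

Definition Beta (a b : R) : R := Gamma a * Gamma b / Gamma (a + b).

(* The factor s gives Phi(0) = 0 for every theta, including theta = 0, where
   Phi(0+) = 1. *)
Definition Phi_beta (alpha theta s : R) : R := s * Beta (1 - alpha) (s + theta).

End Structures.

(* Main.v *)
Require Import Defs.
From HB Require Import structures.
From mathcomp Require Import all_boot all_order all_algebra all_fingroup.
From mathcomp Require Import all_classical all_reals all_analysis.
From mathcomp Require Import measurable_realfun ring lra zify.
Import Order.TTheory GRing.Theory Num.Theory.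
Import numFieldNormedType.Exports.
Local Open Scope ring_scope.
Local Open Scope classical_set_scope.

Set Implicit Arguments.
Unset Strict Implicit.
Unset Printing Implicit Defensive.

(** Up to a constant factor, which cancels in q(n:m), the functional equation of
    Gamma gives Phi(n) = n [1+theta]_(n-1) / [theta+2-alpha]_(n-1); this makes
    sense at alpha = 1 too, where it is Phi(n) = n, the pure drift.  Its
    differences have a closed form, so that, for m < n,
      q(n:m) = C(n,m) [1-alpha]_(m-1) ((n-m) alpha + m theta)
                 / (n [theta+n-m]_m).
    The law of the derived partition is a sum over the orderings of its classes.
    Splitting this sum according to the first class B reduces the partition
    formula to the identity
      \sum_B ((n - |B|) alpha + |B| theta) = n (theta + (k-1) alpha).

    Conversely, let p be regenerative and generate the (alpha,theta) partitions.
    All partition probabilities are nonnegative, which at n = 2 forces 1 - alpha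
    and theta + alpha to have the sign of 1 + theta.
    - If theta < -1, at the first n with theta + n > 0 the partitions {n}, {n,1}
      and {1,...,1}, {2,1,...,1} force both [1-alpha]_(n-1) and
      \prod_i (theta + i alpha) to vanish, so theta is a negative integer and
      the laws do not have total mass 1.
    - If -1 < theta < 0, then q(n:n-1) has the sign of alpha + (n-1) theta,
      which is eventually negative.
    - If alpha < 0, then theta = - n alpha for some n; no partition has more
      than n classes, so q(2n:n) = 0 because n singletons may follow, yet the
      partition {n,n} has positive probability. *)

(** * Composition structures from a Laplace exponent *)

Lemma is_composition_cons n m l :
  is_composition n (m :: l) = (0 < m <= n)%N && is_composition (n - m) l.
Proof.
rewrite /is_composition /=; case: (all _ l); last by rewrite andbF /= !andbF.
by rewrite andbT /=; lia.
Qed.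

Lemma is_composition0 l : is_composition 0 l = (l == [::]).
Proof. by case: l => [|m l] //; rewrite is_composition_cons; case: m. Qed.

Lemma perm_compositions0 : perm_eq (compositions 0) [:: [::]].
Proof.
apply: uniq_perm => [||l]; [exact: compositions_uniq|by []|].
by rewrite mem_compositions is_composition0 inE.
Qed.

(** Splitting off the first part, written [m.+1] to make it positive, is the recursion behind the
    inductions on sums over compositions. *)
Lemma perm_compositionsS n :
  perm_eq (compositions n.+1)
          [seq m.+1 :: l | m <- iota 0 n.+1, l <- compositions (n - m)].
Proof.
apply: uniq_perm; first exact: compositions_uniq.
  apply: allpairs_uniq_dep => [|m _|]; rewrite ?iota_uniq ?compositions_uniq //.
  by move=> [m l] [m' l'] _ _ [-> ->].
move=> l; rewrite mem_compositions; apply/idP/allpairsPdep => [|[m [l' []]]].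
  case: l => [|[|m] l]; rewrite ?is_composition_cons // subSS => /andP[mn cl].
  by exists m, l; rewrite mem_iota mem_compositions.
rewrite mem_iota mem_compositions => mn cl ->.
by rewrite is_composition_cons subSS cl andbT.
Qed.

Lemma big_compositions0 (R : nmodType) (F : seq nat -> R) :
  \sum_(l <- compositions 0) F l = F [::].
Proof. by rewrite (perm_big _ perm_compositions0) big_seq1. Qed.

Lemma big_compositionsS (R : nmodType) n (F : seq nat -> R) :
  \sum_(l <- compositions n.+1) F l =
  \sum_(m < n.+1) \sum_(l <- compositions (n - m)) F (m.+1 :: l).
Proof.
rewrite (perm_big _ (perm_compositionsS n)) big_allpairs_dep /=.
by rewrite -(big_mkord xpredT (fun m => \sum_(l <- compositions (n - m)) F (m.+1 :: l)))
  /index_iota subn0.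
Qed.

Lemma sum_eq_mem (R : pzSemiRingType) (T : eqType) (s : seq T) x (F : T -> R) :
  uniq s -> x \in s -> \sum_(y <- s) F y * (y == x)%:R = F x.
Proof.
move=> us xs; rewrite (bigD1_seq x) //= eqxx mulr1 big1_seq ?addr0 // => y.
by case/andP => /negPf -> _; rewrite mulr0.
Qed.

Lemma box_cons m l i :
  box (m :: l) i = if (i < m)%N then 0%N else (box l (i - m)).+1.
Proof.
rewrite /box /reshape_index /=.
case: ltnP => im; first by have -> : (i.+1 - m = 0)%N by lia.
by rewrite subSn.
Qed.

(** * Discarding a ball, split at the first box *)

Lemma discard_consS m l b :
  (0 < m)%N -> discard (m :: l) b.+1 = m :: discard l b.
Proof. by case: m. Qed.

Lemma discard_cons0 m l : all (leq 1) l ->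
  discard (m :: l) 0 = if (m.-1 == 0)%N then l else m.-1 :: l.
Proof.
move=> l1; rewrite /discard /=.
have -> : [seq x <- l | x != 0%N] = l.
  by apply/all_filterP; apply: sub_all l1 => x; rewrite -lt0n.
by case: eqP.
Qed.

(** The cardinal in [composition_structure] recast as a sum over ball positions, which can be cut
    where the first box ends. *)
Definition discards (k l : seq nat) : nat :=
  \sum_(0 <= i < sumn k) (discard k (box k i) == l).

Lemma card_discards n k l : sumn k = n.+1 ->
  #|finset (fun i : 'I_n.+1 => discard k (box k i) == l)| = discards k l.
Proof.
move=> kn; rewrite /discards kn big_mkord -sum1dep_card big_mkcond /=.
by apply: eq_bigr => i _; case: ifP.
Qed.

(** The balls of the first box all have the same effect, lowering or deleting it; any other ball
    keeps it, so that [l] must start with [m.+1]. *)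
Lemma discards_cons m k l : all (leq 1) k ->
  discards (m.+1 :: k) l =
  (m.+1 * ((if m == 0 then k else m :: k) == l)
   + (if l is a :: l' then (m.+1 == a) * discards k l' else 0))%N.
Proof.
move=> k1; rewrite /discards (big_cat_nat (n := m.+1)) //= ?leq_addr //.
congr addn.
  rewrite (eq_big_nat _ _
    (F2 := fun=> nat_of_bool ((if m == 0 then k else m :: k) == l))).
    by rewrite sum_nat_const_nat subn0.
  by move=> i /andP[_ im]; rewrite box_cons im discard_cons0.
rewrite -{1}[m.+1]add0n big_addn.
have -> : (m.+1 + sumn k - m.+1 = sumn k)%N by lia.
case: l => [|a l].
  rewrite big_nat_cond big1 // => i _.
  by rewrite box_cons ltnNge leq_addl.
rewrite big_distrr /=; apply: eq_big_nat => i _.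
rewrite box_cons ltnNge leq_addl /= discard_consS // addnK eqseq_cons.
by rewrite mulnb.
Qed.

(** * Total mass, consistency and regeneration for a Laplace exponent *)

Section LaplaceStructure.
Variables (R : realType) (Phi : R -> R).

(* In terms of the shift E this is - E^a (1 - E)^m Phi at 0. *)
Definition binomial_difference (a m : nat) : R :=
  \sum_(j < m.+1) (-1) ^+ j.+1 * 'C(m, j)%:R * Phi (a + j)%:R.

Lemma binomial_difference0 a : binomial_difference a 0 = - Phi a%:R.
Proof. by rewrite /binomial_difference big_ord1 expr1 bin0 mulr1 addn0 mulN1r. Qed.

Lemma binomial_differenceS a m :
  binomial_difference a m.+1 =
  binomial_difference a m - binomial_difference a.+1 m.
Proof.
rewrite /binomial_difference big_ord_recl /=.
under eq_bigr do rewrite /bump /= add1n binS natrD mulrDr mulrDl.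
rewrite big_split /= addrA; congr (_ + _).
  rewrite big_ord_recr /= (@bin_small m m.+1) // mulr0 mul0r addr0.
  rewrite [RHS]big_ord_recl /= !bin0; congr (_ + _).
rewrite -sumrN; apply: eq_bigr => i _.
by rewrite addSnnS exprS !mulN1r !mulNr.
Qed.

Lemma binomial_difference1 a :
  binomial_difference a 1 = Phi a.+1%:R - Phi a%:R.
Proof. by rewrite binomial_differenceS !binomial_difference0 opprK addrC. Qed.

(** With E the shift, this is the binomial theorem for (E + (1 - E))^n = 1; the induction follows
    Pascal's rule. *)
Lemma sum_binomial_difference n b :
  \sum_(m < n.+1) 'C(n, m)%:R * binomial_difference (b + (n - m)) m =
  - Phi b%:R.
Proof.
elim: n => [|n IHn].
  by rewrite big_ord1 mul1r addn0 binomial_difference0.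
rewrite -IHn big_ord_recl /= bin0 subn0.
under eq_bigr do rewrite /bump /= add1n subSS binS natrD mulrDl.
rewrite big_split /= addrA big_ord_recr /= (@bin_small n n.+1) // mul0r addr0.
have -> : 1 * binomial_difference (b + n.+1) 0 +
    \sum_(i < n) 'C(n, i.+1)%:R * binomial_difference (b + (n - i)) i.+1 =
    \sum_(i < n.+1) 'C(n, i)%:R * binomial_difference (b + (n - i)).+1 i.
  rewrite [RHS]big_ord_recl /= bin0 subn0 addnS; congr (_ + _).
  apply: eq_bigr => i _; rewrite /bump /= add1n; congr (_ * binomial_difference _ _).
  by have := ltn_ord i; lia.
rewrite -big_split /=; apply: eq_bigr => i _.
by rewrite -mulrDr binomial_differenceS addrC subrK.
Qed.

Lemma Phi_binomE n m :
  Phi_binom Phi n m = 'C(n, m)%:R * binomial_difference (n - m) m.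
Proof. by []. Qed.

Lemma laplace_cpf_nil : laplace_cpf Phi [::] = 1.
Proof. by rewrite /laplace_cpf big_ord0. Qed.

Lemma laplace_cpf_cons m l :
  laplace_cpf Phi (m :: l) = decrement Phi (m + sumn l) m * laplace_cpf Phi l.
Proof. by rewrite /laplace_cpf big_ord_recl. Qed.

Hypothesis Phi0 : Phi 0 = 0.
Hypothesis Phi_neq0 : forall n, (0 < n)%N -> Phi n%:R != 0.

Lemma sum_decrement n : \sum_(m < n.+1) decrement Phi n.+1 m.+1 = 1.
Proof.
(* At [b = 0] the right-hand side is - Phi(0) = 0 and the term [m = 0] is - Phi(n+1), so the other
   terms add up to Phi(n+1). *)
have := sum_binomial_difference n.+1 0.
rewrite Phi0 oppr0 big_ord_recl /= bin0 subn0 add0n binomial_difference0 mul1r.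
rewrite addrC => /(canRL (addrK _)); rewrite opprK add0r => E.
rewrite -mulr_suml /= -{2}(divff (Phi_neq0 (ltn0Sn n))); congr (_ / _).
by rewrite -E; apply: eq_bigr => i _; rewrite Phi_binomE.
Qed.

(* One ball is thrown away from the first box, or forms a singleton first box
   and is thrown away, or is thrown away from the rest. *)
Lemma decrement_consistent N a : (0 < a <= N)%N ->
  N.+1%:R * decrement Phi N a =
  a.+1%:R * decrement Phi N.+1 a.+1 + decrement Phi N.+1 1 * decrement Phi N a
  + (N - a).+1%:R * decrement Phi N.+1 a.
Proof.
move=> /andP[a0 aN]; rewrite /decrement !Phi_binomE subSS subn1 /= bin1.
rewrite subSn // binomial_difference1 binomial_differenceS.
(* Both products become [N.+1%:R * 'C(N, a)%:R], so [D - D'] and [D'] add up to [D], and 1/f' + (f'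
   - f)/(f f') = 1/f remains. *)
have h1 : a.+1%:R * 'C(N.+1, a.+1)%:R = N.+1%:R * 'C(N, a)%:R :> R.
  by rewrite -!natrM mul_bin_diag.
have h2 : (N - a).+1%:R * 'C(N.+1, a)%:R = N.+1%:R * 'C(N, a)%:R :> R.
  by rewrite -!natrM -subSn // -mul_bin_down.
have f0 : Phi N%:R != 0 by apply: Phi_neq0; lia.
have f1 := Phi_neq0 (ltn0Sn N).
set D := binomial_difference (N - a) a.
set D' := binomial_difference (N - a).+1 a.
have -> : a.+1%:R * ('C(N.+1, a.+1)%:R * (D - D') / Phi N.+1%:R) =
    N.+1%:R * 'C(N, a)%:R * (D - D') / Phi N.+1%:R by rewrite -h1 !mulrA.
have -> : (N - a).+1%:R * ('C(N.+1, a)%:R * D' / Phi N.+1%:R) =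
    N.+1%:R * 'C(N, a)%:R * D' / Phi N.+1%:R by rewrite -h2 !mulrA.
move: f0 f1; set f := Phi N%:R; set f' := Phi _; move: f f' => f f' f0 f1.
by field; rewrite f0 f1.
Qed.

Lemma laplace_cpf_sum1 n : \sum_(l <- compositions n) laplace_cpf Phi l = 1.
Proof.
have [k] := ubnP n; elim: k n => // k IHk [|n] nk.
  by rewrite big_compositions0 laplace_cpf_nil.
rewrite big_compositionsS -[RHS](sum_decrement n); apply: eq_bigr => m _.
rewrite -[RHS]mulr1 -(IHk (n - m)%N); last by lia.
rewrite big_distrr /=; apply: eq_big_seq => l.
rewrite mem_compositions => /andP[_ /eqP ls].
by rewrite laplace_cpf_cons ls; congr (decrement _ _ _ * _); have := ltn_ord m; lia.
Qed.

(** This is consistency multiplied by [n.+1], by induction on [l]; [decrement_consistent] collects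
    the three cases for the first part of [k]. The case [n = 0] is included because the induction
    ends in the empty composition. *)
Lemma laplace_cpf_discards n l : is_composition n l ->
  \sum_(k <- compositions n.+1) laplace_cpf Phi k * (discards k l)%:R =
  n.+1%:R * laplace_cpf Phi l.
Proof.
elim: l n => [|[|a] l IHl] n; rewrite ?is_composition_cons //.
  case/andP => _ /eqP <- /=.
  rewrite big_compositionsS big_ord1 big_compositions0 discards_cons //.
  rewrite laplace_cpf_cons laplace_cpf_nil.
  by have := sum_decrement 0; rewrite big_ord1 => ->; rewrite !mul1r.
case: n => // n /andP[an]; rewrite subSS => cl.
rewrite big_compositionsS.
pose P (m : nat) k : R := laplace_cpf Phi (m.+1 :: k).
(* To reach [a.+1 :: l], the larger composition has a singleton in front of it, or starts with
   [a.+2], or starts with [a.+1] and loses a ball further on. The cases overlap at [m = a = 0],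
   hence a sum of three terms. *)
have E (m : 'I_n.+2) : \sum_(k <- compositions (n.+1 - m))
    laplace_cpf Phi (m.+1 :: k) * (discards (m.+1 :: k) (a.+1 :: l))%:R =
  (if m == 0%N :> nat then P 0%N (a.+1 :: l) else 0)
  + (if m == a.+1 :> nat then a.+2%:R * P a.+1 l else 0)
  + (if m == a :> nat then \sum_(k <- compositions (n - a).+1)
         P a k * (discards k l)%:R else 0).
  transitivity (\sum_(k <- compositions (n.+1 - m)) P m k * (m.+1 *
      ((if m == 0 :> nat then k else (nat_of_ord m) :: k) == a.+1 :: l))%:R +
      \sum_(k <- compositions (n.+1 - m)) P m k * ((m == a :> nat) * discards k l)%:R).
    rewrite -big_split; apply: eq_big_seq => k.
    rewrite mem_compositions => /andP[k1 _].
    by rewrite discards_cons // natrD mulrDr eqSS.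
  congr (_ + _).
    have [m0|m0] := eqVneq (nat_of_ord m) 0%N.
      rewrite m0 /= addr0 subn0; under eq_bigr do rewrite mul1n.
      apply: sum_eq_mem; first exact: compositions_uniq.
      by rewrite mem_compositions is_composition_cons an subSS.
    have [->|ma] := eqVneq (nat_of_ord m) a.+1.
      rewrite add0r; under eq_bigr do rewrite eqseq_cons eqxx /= natrM mulrCA.
      rewrite -big_distrr /= sum_eq_mem ?compositions_uniq //.
      by rewrite mem_compositions subSS.
    rewrite addr0 big1 // => k _.
    by rewrite eqseq_cons (negPf ma) muln0 mulr0.
  have [->|ma] := eqVneq (nat_of_ord m) a.
    by rewrite subSn //; apply: eq_bigr => k _; rewrite mul1n.
  by rewrite big1 // => k _; rewrite mul0n mulr0.
rewrite (eq_bigr _ (fun m _ => E m)) !big_split /=.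
have pick1 (x : nat) (F : R) : (x < n.+2)%N ->
    \sum_(m < n.+2) (if m == x :> nat then F else 0) = F.
  move=> xn; rewrite (bigD1 (Ordinal xn)) //= eqxx big1 ?addr0 // => i.
  by rewrite -val_eqE /= => /negPf ->.
rewrite !pick1 //; last by lia.
rewrite /P {P E pick1}.
have ls : sumn l = (n - a)%N by case/andP: cl => _ /eqP.
have -> : \sum_(k <- compositions (n - a).+1) 
      laplace_cpf Phi (a.+1 :: k) * (discards k l)%:R = decrement Phi n.+2 a.+1 * ((n - a).+1%:R * laplace_cpf Phi l).
  rewrite -IHl // big_distrr /=; apply: eq_big_seq => k.
  rewrite mem_compositions => /andP[_ /eqP ks].
  by rewrite laplace_cpf_cons ks mulrA; congr (decrement _ _ _ * _ * _); lia.
have Ea : (a.+1 + (n - a) = n.+1)%N by lia.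
rewrite !laplace_cpf_cons /= ls addSn Ea.
rewrite add0n addSn Ea [RHS]mulrA decrement_consistent // subSS.
by ring.
Qed.

Hypothesis decrement_ge0 :
  forall n m, (0 < m <= n)%N -> 0 <= decrement Phi n m.

Lemma laplace_cpf_ge0 n l : is_composition n l -> 0 <= laplace_cpf Phi l.
Proof.
elim: l n => [|m l IHl] n; first by rewrite laplace_cpf_nil.
rewrite is_composition_cons => /andP[mn /IHl l0].
by rewrite laplace_cpf_cons mulr_ge0 // decrement_ge0 // leq_addr; case/andP: mn => ->.
Qed.

Lemma laplace_composition_structure : composition_structure (laplace_cpf Phi).
Proof.
split=> [n l _|]; first exact: laplace_cpf_ge0.
split=> [n _|n l _ cl]; first exact: laplace_cpf_sum1.
have n0 : n.+1%:R != 0 :> R by rewrite pnatr_eq0.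
apply: (mulfI n0); rewrite -laplace_cpf_discards // big_distrr /=.
apply: eq_big_seq => k; rewrite mem_compositions => /andP[_ /eqP ks].
by rewrite card_discards // [RHS]mulrC -[RHS]mulrA divfK.
Qed.

Lemma laplace_first_part n m : (0 < m <= n)%N ->
  first_part (laplace_cpf Phi) n m = decrement Phi n m.
Proof.
case: n m => [|n] [|m] // mn; rewrite /first_part big_mkcond big_compositionsS /=.
rewrite (bigD1 (Ordinal mn)) //= [X in _ + X]big1 ?addr0; last first.
  move=> i; rewrite -val_eqE /= => /negPf im; apply: big1 => l _.
  by rewrite eqSS im.
rewrite eqxx -[RHS]mulr1 -(laplace_cpf_sum1 (n - m)) big_distrr /=.
apply: eq_big_seq => l; rewrite mem_compositions => /andP[_ /eqP ls].
by rewrite laplace_cpf_cons ls; congr (decrement _ _ _ * _); lia.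
Qed.

Lemma laplace_regenerative_structure :
  regenerative_composition_structure (laplace_cpf Phi).
Proof.
split; first exact: laplace_composition_structure.
move=> n m l /andP[m0 mn] /andP[_ /eqP ls].
rewrite laplace_first_part ?m0 1?ltnW // => q0.
by rewrite laplace_cpf_cons ls subnKC 1?ltnW // mulrC mulKf.
Qed.

End LaplaceStructure.

(** * The two-parameter decrement matrix *)

Lemma rising0 (R : realType) (x : R) : rising x 0 = 1.
Proof. by rewrite /rising big_ord0. Qed.

Lemma risingS (R : realType) (x : R) n : rising x n.+1 = rising x n * (x + n%:R).
Proof. by rewrite /rising big_ord_recr. Qed.

Lemma rising_gt0 (R : realType) (x : R) n : 0 < x -> 0 < rising x n.
Proof.
by move=> x0; rewrite /rising; apply: prodr_gt0 => i _; rewrite ltr_wpDr.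
Qed.

Lemma rising_ge0 (R : realType) (x : R) n : 0 <= x -> 0 <= rising x n.
Proof. by move=> x0; rewrite /rising; apply: prodr_ge0 => i _; rewrite addr_ge0. Qed.

Lemma two_parameter_shape_gt0 (R : realType) (alpha theta : R) :
  0 <= alpha <= 1 -> 0 <= theta -> 0 < theta + 2 - alpha.
Proof. by lra. Qed.

(** * Closed forms covering both [Phi_beta] for alpha < 1 and the pure drift at alpha = 1 *)

Section TwoParameterDecrement.
Variables (R : realType) (alpha theta c : R) (Phi : R -> R).
Hypothesis alpha01 : 0 <= alpha <= 1.
Hypothesis theta0 : 0 <= theta.
Hypothesis c_gt0 : 0 < c.
Hypothesis Phi0 : Phi 0 = 0.
Hypothesis PhiS : forall n,
  Phi n.+1%:R = c * n.+1%:R * rising (1 + theta) n / rising (theta + 2 - alpha) n.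

Let den_gt0 n : 0 < rising (theta + 2 - alpha) n.
Proof. exact/rising_gt0/two_parameter_shape_gt0. Qed.

Let den_neq0 n : rising (theta + 2 - alpha) n != 0.
Proof. by rewrite gt_eqF. Qed.

Let num_gt0 n : 0 < rising (1 + theta) n.
Proof. by apply: rising_gt0; rewrite ltr_wpDr. Qed.

Let denS_neq0 (n : nat) : theta + 2 - alpha + n%:R != 0.
Proof.
by rewrite gt_eqF // ltr_wpDr // two_parameter_shape_gt0.
Qed.

Lemma two_parameter_Phi_gt0 n : (0 < n)%N -> 0 < Phi n%:R.
Proof. by case: n => // n _; rewrite PhiS divr_gt0 ?mulr_gt0. Qed.

(** By induction on [m]: with A = (b+1) alpha + (m+1) theta, the step comes down to A (theta + 3 -
    alpha + b + m) - (A + alpha) (1 + theta + b) = (1 - alpha + m) (A + theta). *)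
Lemma two_parameter_difference b m :
  binomial_difference Phi b.+1 m.+1 =
  c * rising (1 - alpha) m * (b.+1%:R * alpha + m.+1%:R * theta)
  * rising (1 + theta) b / rising (theta + 2 - alpha) (b + m).+1.
Proof.
elim: m b => [|m IHm] b.
  rewrite binomial_difference1 !PhiS addn0 rising0 !risingS.
  move: (den_neq0 b) (denS_neq0 b) => /=; set r := rising _ b; set s := rising _ b.
  by move=> r0 s0; field; rewrite r0 s0.
rewrite binomial_differenceS !IHm addSn addnS !risingS.
move: (den_neq0 (b + m)) (denS_neq0 (b + m)) (denS_neq0 (b + m).+1).
set r := rising (theta + _ - _) _; set s := rising _ b; set t := rising _ m.
move=> r0 s0 s1; field.
by rewrite -natrD nat1r s1 s0 r0.
Qed.

(** The point 0 lies outside the range of [PhiS] and is governed by [Phi0]; this is the case of a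
    first box that takes all balls. *)
Lemma two_parameter_difference0 m :
  binomial_difference Phi 0 m.+1 =
  c * m.+1%:R * rising (1 - alpha) m / rising (theta + 2 - alpha) m.
Proof.
elim: m => [|m IHm].
  by rewrite binomial_difference1 PhiS Phi0 !rising0 subr0.
rewrite binomial_differenceS IHm two_parameter_difference add0n rising0 !risingS.
move: (den_neq0 m) (denS_neq0 m).
set r := rising (theta + _ - _) _; set t := rising _ m.
by move=> r0 s0; field; rewrite r0 s0.
Qed.

Lemma two_parameter_decrement b m :
  decrement Phi (m.+1 + b.+1) m.+1 =
  'C(m.+1 + b.+1, m.+1)%:R * rising (1 - alpha) m
  * (b.+1%:R * alpha + m.+1%:R * theta) * rising (1 + theta) b
  / ((m.+1 + b.+1)%:R * rising (1 + theta) (m + b).+1).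
Proof.
rewrite /decrement Phi_binomE addKn two_parameter_difference addnS PhiS /=.
rewrite addSn (addnC b m).
have n0 : (m + b).+2%:R != 0 :> R by rewrite pnatr_eq0.
move: (den_neq0 (m + b).+1) (lt0r_neq0 (num_gt0 (m + b).+1)) (lt0r_neq0 c_gt0).
set r := rising (theta + _ - _) _; set s := rising _ (m + b).+1.
move: n0; set x := _.+2%:R; move: x => x x0 r0 s0 c0.
by field; rewrite s0 x0 r0 c0.
Qed.

Lemma two_parameter_decrement_full m :
  decrement Phi m.+1 m.+1 = rising (1 - alpha) m / rising (1 + theta) m.
Proof.
rewrite /decrement Phi_binomE subnn two_parameter_difference0 binn mul1r PhiS.
have n0 : m.+1%:R != 0 :> R by rewrite pnatr_eq0.
move: (den_neq0 m) (lt0r_neq0 (num_gt0 m)) (lt0r_neq0 c_gt0).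
set r := rising (theta + _ - _) _; set s := rising (1 + theta) _.
move: n0; set x := _.+1%:R; move: x => x x0 r0 s0 c0.
by field; rewrite s0 x0 r0 c0.
Qed.

Lemma two_parameter_decrement_ge0 n m :
  (0 < m <= n)%N -> 0 <= decrement Phi n m.
Proof.
case: m => // m /andP[_ mn]; have a1 : 0 <= 1 - alpha.
  by rewrite subr_ge0; case/andP: alpha01.
have a0 : 0 <= alpha by case/andP: alpha01.
have n0 i : 0 <= rising (1 + theta) i by apply: ltW.
rewrite -(subnKC mn); case: (n - _)%N => [|b].
  by rewrite addn0 two_parameter_decrement_full divr_ge0 ?n0 ?rising_ge0.
rewrite two_parameter_decrement; apply: divr_ge0; last by rewrite mulr_ge0.
by rewrite !mulr_ge0 ?n0 ?rising_ge0 ?a1 ?addr_ge0 ?mulr_ge0.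
Qed.

Lemma two_parameter_regenerative :
  regenerative_composition_structure (laplace_cpf Phi).
Proof.
apply: laplace_regenerative_structure => //; last exact: two_parameter_decrement_ge0.
by move=> n n0; rewrite gt_eqF // two_parameter_Phi_gt0.
Qed.

End TwoParameterDecrement.

(** * Orderings of the classes of a derived partition *)

Section LabelledPartitions.
Local Open Scope set_scope.

Lemma sum_box_eq l j :
  (\sum_(0 <= i < sumn l) (box l i == j) = nth 0 l j)%N.
Proof.
elim: l j => [|m l IHl] j; first by rewrite big_geq ?nth_nil.
rewrite (big_cat_nat (n := m)) //= ?leq_addr //.
rewrite (eq_big_nat _ _ (F2 := fun=> nat_of_bool (0%N == j))); last first.
  by move=> i /andP[_ im]; rewrite box_cons im.
rewrite sum_nat_const_nat subn0 -[X in \sum_(X <= _ < _) _]add0n big_addn addKn.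
rewrite (eq_bigr (fun i => nat_of_bool ((box l i).+1 == j))); last first.
  by move=> i _; rewrite box_cons ltnNge leq_addl addnK.
case: j => [|j] /=; first by rewrite big1 // muln1 addn0.
by rewrite muln0 add0n -IHl; apply: eq_bigr => i _; rewrite eqSS.
Qed.

Lemma box_lt l i : (i < sumn l)%N -> (box l i < size l)%N.
Proof. exact: reshape_indexP. Qed.

(** * The classes of a labelled composition, in box order *)

Section Blocks.
Variables (n : nat) (l : seq nat) (s : 'S_n).
Hypothesis l_comp : is_composition n l.

Let l_sum : sumn l = n. Proof. by case/andP: l_comp => _ /eqP. Qed.

Definition block (j : nat) : {set 'I_n} := [set x | box l ((s^-1)%g x) == j].

(** Unlike [labelled_partition], this keeps the order of the boxes: it is the exchangeable ordered
    partition. *)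
Definition blocks : seq {set 'I_n} := mkseq block (size l).

Lemma card_block j : #|block j| = nth 0%N l j.
Proof.
have -> : block j = s @: [set i : 'I_n | box l i == j].
  apply/setP => x; rewrite inE; apply/idP/imsetP => [bx|[i]].
    by exists ((s^-1)%g x); rewrite ?inE ?permKV.
  by rewrite inE => bi ->; rewrite permK.
rewrite card_imset; last exact: perm_inj.
rewrite -sum_box_eq l_sum big_mkord -sum1dep_card big_mkcond /=.
by apply: eq_bigr => i _; case: ifP.
Qed.

Lemma map_card_blocks : [seq #|B| | B : {set 'I_n} <- blocks] = l.
Proof.
apply: (@eq_from_nth _ 0%N) => [|j]; rewrite ?size_map ?size_iota // => jl.
by rewrite (nth_map finset.set0) ?size_mkseq // nth_mkseq // card_block.
Qed.

Lemma blocks_neq0 B : B \in blocks -> B != finset.set0.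
Proof.
case/mapP => j; rewrite mem_iota => jl ->.
rewrite -card_gt0 card_block.
by case/andP: l_comp => /allP l1 _; apply/l1/mem_nth.
Qed.

Lemma blocks_uniq : uniq blocks.
Proof.
apply/(mkseq_uniqP block (size l)) => i j il _ E.
have : block i != finset.set0 by apply/blocks_neq0/map_f; rewrite mem_iota.
case/finset.set0Pn => x xi; have := xi; rewrite E; move: xi; rewrite !inE.
by move=> /eqP <- /eqP <-.
Qed.

Lemma labelled_partitionE : labelled_partition l s = [set B in blocks].
Proof.
have pE x : [set y in [set: 'I_n] | box l ((s^-1)%g x) == box l ((s^-1)%g y)] =
            block (box l ((s^-1)%g x)).
  by apply/setP => y; rewrite !inE eq_sym.
apply/setP => B; rewrite inE; apply/imsetP/mapP => [[x _ ->]|[j]].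
  by exists (box l ((s^-1)%g x)); rewrite ?pE // mem_iota /= box_lt // l_sum.
move=> jl E; have : B != finset.set0 by rewrite blocks_neq0 // E map_f.
case/finset.set0Pn => x; rewrite E inE => /eqP jE; exists x => //.
by rewrite pE jE.
Qed.

(** Boxes are nonempty and disjoint, so [blocks] has no repetition, and producing [P] means listing
    its classes in some order. *)
Lemma labelled_partition_eq (P : {set {set 'I_n}}) :
  (labelled_partition l s == P) = (blocks \in permutations (enum P)).
Proof.
rewrite labelled_partitionE mem_permutations; apply/eqP/idP => [<-|E].
  apply: uniq_perm; rewrite ?blocks_uniq ?enum_uniq // => B.
  by rewrite mem_enum inE.
by apply/setP => B; rewrite inE (perm_mem E) mem_enum.
Qed.

(** Membership of every [s i] only gives inclusions between classes; the prescribed cardinals turn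
    them into equalities. *)
Lemma blocks_eq (w : seq {set 'I_n}) : [seq #|B| | B : {set 'I_n} <- w] = l ->
  (blocks == w) = [forall i, s i \in nth finset.set0 w (box l i)].
Proof.
move=> wl; have ws : size w = size l by rewrite -wl size_map.
apply/eqP/forallP => [<- i|sw].
  by rewrite nth_mkseq ?inE ?permK // box_lt // l_sum.
apply: (@eq_from_nth _ finset.set0); rewrite size_mkseq ?ws // => j jl.
rewrite nth_mkseq //; apply/eqP; rewrite eqEcard; apply/andP; split.
  by apply/fintype.subsetP => x; rewrite inE => /eqP <-; rewrite -{1}[x](permKV s).
by rewrite card_block -wl (nth_map finset.set0) ?ws.
Qed.

End Blocks.

(** * Counting the permutations that put given classes into given boxes *)

Section Counting.
Variable T : finType.

(** Here [u] is meant to be the word of values of a permutation; the recursive form lets the count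
    proceed class by class. *)
Fixpoint fits (w : seq {set T}) (u : seq T) : bool :=
  if w is B :: w' then all (mem B) (take #|B| u) && fits w' (drop #|B| u)
  else true.

Lemma fitsP (w : seq {set T}) (u : seq T) (x0 : T) :
  size u = sumn [seq #|B| | B : {set T} <- w] ->
  reflect (forall i, (i < size u)%N ->
    nth x0 u i \in nth finset.set0 w (box [seq #|B| | B : {set T} <- w] i)) (fits w u).
Proof.
elim: w u => [|B w IHw] u /= us.
  by apply: (iffP idP) => // _ i; rewrite us.
have Bu : (#|B| <= size u)%N by rewrite us leq_addr.
have ds : size (drop #|B| u) = sumn [seq #|C| | C : {set T} <- w].
  by rewrite size_drop us addKn.
apply: (iffP andP) => [[/all_nthP tB /(IHw _ ds) dw] i iu|uw].
  rewrite box_cons; case: ltnP => iB /=.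
    by have := tB x0 i; rewrite nth_take // size_takel //; apply.
  have := dw (i - #|B|)%N; rewrite nth_drop subnKC //; apply.
  by rewrite size_drop ltn_sub2r // (leq_ltn_trans iB).
split.
  apply/(all_nthP x0) => i; rewrite size_takel // => iB.
  by have := uw i; rewrite nth_take // box_cons iB /=; apply; apply: leq_trans Bu.
apply/IHw => // i; rewrite size_drop nth_drop => iu.
have := uw (#|B| + i)%N; rewrite box_cons [(_ < #|B|)%N]ltnNge leq_addr /= addKn; apply.
by rewrite -ltn_subRL.
Qed.

(** Cutting [u] after the first class gives an arrangement of [B] followed by a fitting arrangement
    of the rest, hence one factorial per class. *)
Lemma size_fits_permutations (w : seq {set T}) :
  uniq (flatten [seq enum B | B : {set T} <- w]) ->
  size [seq u <- permutations (flatten [seq enum B | B : {set T} <- w]) | fits w u] =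
  (\prod_(m <- [seq #|B| | B : {set T} <- w]) m`!)%N.
Proof.
elim: w => [|B w IHw] /=; first by rewrite big_nil.
set F := flatten _ => uBF; have := uBF; rewrite cat_uniq => /and3P[uB _ uF].
rewrite big_cons -{}IHw // -/F [in RHS]cardE -size_permutations //.
rewrite -(size_allpairs cat); apply: perm_size.
apply: uniq_perm => [||u].
- by rewrite filter_uniq ?permutations_uniq.
- apply: allpairs_uniq => [||[a b] [a' b']] /=.
  + exact: permutations_uniq.
  + by rewrite filter_uniq ?permutations_uniq.
  case/allpairsP => -[a1 b1] /= [a1B _ [-> ->]].
  case/allpairsP => -[a2 b2] /= [a2B _ [-> ->]].
  move: a1B a2B; rewrite !mem_permutations => /perm_size s1 /perm_size s2.
  by move=> /eqP; rewrite eqseq_cat ?s1 ?s2 // => /andP[/eqP -> /eqP ->].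
rewrite mem_filter; apply/idP/allpairsP => [|[[a b] /= []]].
  rewrite mem_permutations -andbA => /and3P[tB fw pu].
  have uu : uniq u by rewrite (perm_uniq pu).
  have su : size u = (#|B| + size F)%N by rewrite (perm_size pu) size_cat cardE.
  exists (take #|B| u, drop #|B| u); rewrite /= cat_take_drop mem_filter fw.
  (* A word of length [#|B|] in [B] without repetition exhausts [B], which leaves an arrangement of
     [F]. *)
  have pB : perm_eq (take #|B| u) (enum B).
    apply: uniq_perm; rewrite ?take_uniq ?enum_uniq //.
    have tB' : {subset take #|B| u <= enum B}.
      by move=> x /(allP tB); rewrite mem_enum.
    have [||//] := uniq_min_size _ tB'; first exact: take_uniq.
    by rewrite size_takel -?cardE // su leq_addr.
  split; rewrite ?mem_permutations //.
  by rewrite -(perm_cat2l (enum B)) -(permPr pu) -{2}(cat_take_drop #|B| u)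
    perm_cat2r perm_sym.
rewrite mem_filter !mem_permutations => pa /andP[fb pb] ->.
have sa : size a = #|B| by rewrite (perm_size pa) cardE.
rewrite -sa take_size_cat // drop_size_cat // fb perm_cat // !andbT.
by apply/allP => x; rewrite (perm_mem pa) mem_enum.
Qed.

End Counting.
End LabelledPartitions.

(** * The derived law as a sum over the orderings of the classes *)

Section DerivedLaw.
Local Open Scope set_scope.

Lemma card_blocks_eq n l (w : seq {set 'I_n.+1}) :
  is_composition n.+1 l -> [seq #|B| | B : {set 'I_n.+1} <- w] = l ->
  perm_eq (flatten [seq enum B | B : {set 'I_n.+1} <- w]) (enum 'I_n.+1) ->
  #|[set s : 'S_n.+1 | blocks l s == w]| = (\prod_(m <- l) m`!)%N.
Proof.
move=> cl wl pw; have /andP[_ /eqP sl] := cl.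
pose f (s : 'S_n.+1) := [seq s i | i <- enum 'I_n.+1].
have sf s : size (f s) = n.+1 by rewrite size_map size_enum_ord.
have nf s (i : 'I_n.+1) : nth ord0 (f s) i = s i.
  by rewrite (nth_map ord0) ?size_enum_ord // nth_ord_enum.
have f_inj : injective f.
  by move=> s t st; apply/permP => i; rewrite -!nf st.
have blocks_fits s : (blocks l s == w) = fits w (f s).
  rewrite (blocks_eq s cl wl); apply/forallP/(fitsP ord0); rewrite ?wl ?sf //.
    by move=> h i iN; have := h (Ordinal iN); rewrite -nf.
  by move=> h i; have := h i (ltn_ord i); rewrite nf.
rewrite cardE -(size_map f) -[in RHS]wl -size_fits_permutations; last first.
  by rewrite (perm_uniq pw) enum_uniq.
apply/perm_size/uniq_perm => [||u].
- by rewrite map_inj_uniq ?enum_uniq.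
- by rewrite filter_uniq ?permutations_uniq.
rewrite mem_filter mem_permutations (permPr pw); apply/mapP/andP => [[s]|[fu pu]].
  rewrite mem_enum inE blocks_fits => fs ->; split=> //.
  apply: uniq_perm => [||x].
  - by rewrite map_inj_uniq ?enum_uniq //; exact: perm_inj.
  - exact: enum_uniq.
  rewrite [RHS]mem_enum; apply/mapP; exists ((s^-1)%g x).
    by rewrite mem_enum.
  by rewrite permKV.
have su : size u = n.+1 by rewrite (perm_size pu) size_enum_ord.
have uu : uniq u by rewrite (perm_uniq pu) enum_uniq.
have g_inj : injective (fun i : 'I_n.+1 => nth ord0 u i).
  by move=> i j /eqP; rewrite nth_uniq ?su // => /eqP/val_inj.
have fg : f (perm g_inj) = u.
  apply: (@eq_from_nth _ ord0); rewrite ?sf ?su // => i iN.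
  by rewrite (nf _ (Ordinal iN)) permE.
by exists (perm g_inj); rewrite // mem_enum inE blocks_fits fg.
Qed.

(** The concatenation covers ['I_n] and, by the sizes of the classes, has length [n], so it has no
    repetition. *)
Lemma perm_flatten_partition n (P : {set {set 'I_n}}) w :
  finset.partition P [set: 'I_n] -> w \in permutations (enum P) ->
  perm_eq (flatten [seq enum B | B : {set 'I_n} <- w]) (enum 'I_n).
Proof.
rewrite mem_permutations => PT pw.
have sub : {subset enum 'I_n <= flatten [seq enum B | B : {set 'I_n} <- w]}.
  move=> x _; have : x \in finset.cover P by rewrite (cover_partition PT) inE.
  case/bigcupP => B BP xB; apply/flattenP; exists (enum B); last by rewrite mem_enum.
  by apply/mapP; exists B; rewrite // (perm_mem pw) mem_enum.
have sz : (size (flatten [seq enum B | B : {set 'I_n} <- w]) <= size (enum 'I_n))%N.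
  rewrite size_flatten /shape -map_comp sumnE big_map size_enum_ord.
  rewrite (perm_big _ pw) /= big_enum /=.
  under eq_bigr do rewrite -cardE.
  by rewrite -(card_partition PT) cardsT card_ord.
apply: uniq_perm; rewrite ?enum_uniq //.
  exact: leq_size_uniq (enum_uniq _) sub sz.
by case: (uniq_min_size (enum_uniq _) sub sz) => _ E x; rewrite E.
Qed.

Lemma is_composition_partition n (P : {set {set 'I_n}}) w :
  finset.partition P [set: 'I_n] -> w \in permutations (enum P) ->
  is_composition n [seq #|B| | B : {set 'I_n} <- w].
Proof.
move=> PT pw; apply/andP; split.
  apply/allP => _ /mapP[B Bw ->]; rewrite card_gt0.
  rewrite (partition_neq0 PT) // -mem_enum.
  by move: pw; rewrite mem_permutations => /perm_mem <-.
have /perm_size := perm_flatten_partition PT pw.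
rewrite size_flatten /shape -map_comp size_enum_ord => E.
by apply/eqP; rewrite -[RHS]E; congr sumn; apply: eq_map => B /=; rewrite cardE.
Qed.

(** A given order [w] of the classes arises only from the composition formed by its sizes, and there
    from exactly prod |B|! of the n! labellings. *)
Lemma derived_lawE (R : realType) (p : seq nat -> R) n (P : {set {set 'I_n}}) :
  (0 < n)%N -> finset.partition P [set: 'I_n] ->
  derived_law p P =
  (\prod_(B in P) (#|B|)`!)%:R / n`!%:R *
  \sum_(w <- permutations (enum P)) p [seq #|B| | B : {set 'I_n} <- w].
Proof.
case: n P => // n P _ PT; rewrite /derived_law.
have E l : l \in compositions n.+1 ->
    #|[set s : 'S_n.+1 | labelled_partition l s == P]|%:R =
    (\prod_(B in P) (#|B|)`!)%:R * \sum_(w <- permutations (enum P))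
      ([seq #|B| | B : {set 'I_n.+1} <- w] == l)%:R :> R.
  rewrite mem_compositions => cl.
  rewrite -natr_sum -natrM; congr _%:R; rewrite big_distrr /=.
  rewrite -sum1dep_card.
  under eq_bigl do rewrite (labelled_partition_eq _ cl).
  rewrite big_mkcond /=.
  rewrite (eq_bigr (fun s => \sum_(w <- permutations (enum P)) (blocks l s == w))%N).
    rewrite exchange_big /=; apply: eq_big_seq => w wP.
    have [wl|wl] := eqVneq; last first.
      rewrite muln0 big1 // => s _; case: eqP => // bw; case/eqP: wl.
      by rewrite -bw map_card_blocks.
    have -> : (\prod_(B in P) (#|B|)`! = \prod_(m <- l) m`!)%N.
      rewrite -big_enum /= (perm_big w); last by rewrite perm_sym -mem_permutations.
      by rewrite -wl big_map.
    rewrite muln1 -(card_blocks_eq cl wl); last exact: perm_flatten_partition PT wP.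
    rewrite -sum1dep_card [RHS]big_mkcond /=.
    by apply: eq_bigr => s _; case: ifP.
  move=> s _; transitivity (blocks l s \in permutations (enum P) : nat).
    by case: ifP.
  rewrite -count_uniq_mem ?permutations_uniq //.
  rewrite -sum1_count big_mkcond /=; apply: eq_bigr => w _.
  by rewrite eq_sym; case: ifP.
rewrite big_distrr /=.
transitivity (\sum_(l <- compositions n.+1) \sum_(w <- permutations (enum P))
    (\prod_(B in P) (#|B|)`!)%:R / n.+1`!%:R *
    (p l * ([seq #|B| | B : {set 'I_n.+1} <- w] == l)%:R)).
  apply: eq_big_seq => l lc; rewrite (E l lc) -!big_distrr /=.
  by ring.
rewrite exchange_big; apply: eq_big_seq => w wP /=.
under eq_bigr do rewrite eq_sym.
rewrite -big_distrr /= sum_eq_mem ?compositions_uniq // mem_compositions.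
exact: is_composition_partition PT wP.
Qed.

End DerivedLaw.

(** * The two-parameter partition probabilities *)

(** The partition formula as a function of the class sizes alone, in any order, so that it can be
    compared with [p] on compositions. *)
Definition eppf (R : realType) (alpha theta : R) (l : seq nat) : R :=
  (\prod_(1 <= i < size l) (theta + alpha * i%:R)) / rising (1 + theta) (sumn l).-1
  * \prod_(m <- l) rising (1 - alpha) m.-1.

Lemma two_parameter_lawE (R : realType) (alpha theta : R) n
    (P : {set {set 'I_n}}) w :
  finset.partition P [set: 'I_n]%SET -> w \in permutations (enum P) ->
  two_parameter_law alpha theta P =
  eppf alpha theta [seq #|B| | B : {set 'I_n} <- w].
Proof.
move=> PT pw; have /andP[_ /eqP sw] := is_composition_partition PT pw.
rewrite mem_permutations in pw.
rewrite /two_parameter_law /eppf sw size_map (perm_size pw) -cardE big_map.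
by rewrite (perm_big _ pw) /= big_enum.
Qed.

(** * Summing the regenerative law over the orderings *)

Section TwoParameterOrderings.
Variables (R : realType) (alpha theta c : R) (Phi : R -> R).
Hypothesis alpha01 : 0 <= alpha <= 1.
Hypothesis theta0 : 0 <= theta.
Hypothesis c_gt0 : 0 < c.
Hypothesis Phi0 : Phi 0 = 0.
Hypothesis PhiS : forall n,
  Phi n.+1%:R = c * n.+1%:R * rising (1 + theta) n / rising (theta + 2 - alpha) n.

Variables (T : eqType) (sz : T -> nat).
Hypothesis sz_gt0 : forall x, (0 < sz x)%N.

Lemma sum_orderings_cons (F : seq nat -> R) (w : seq T) : uniq w -> w != [::] ->
  \sum_(v <- permutations w) F (map sz v) =
  \sum_(x <- w) \sum_(v <- permutations (rem x w)) F (sz x :: map sz v).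
Proof.
move=> uw w0; rewrite (perm_big _ (permutationsE _)) ?lt0n ?size_eq0 //=.
by rewrite big_allpairs_dep undup_id.
Qed.

(** Elements with sizes are ordered, rather than the sizes themselves, so that equal sizes count
    separately and the first class can be removed in the induction. *)
Lemma sum_orderings_laplace (w : seq T) : uniq w -> w != [::] ->
  \sum_(v <- permutations w) laplace_cpf Phi (map sz v) =
  (sumn (map sz w))`!%:R / (\prod_(x <- w) (sz x)`!)%:R
  * eppf alpha theta (map sz w).
Proof.
have [k] := ubnP (size w); elim: k w => // k IHk w wk uw w0.
rewrite sum_orderings_cons //.
(* A single class fills the first box with all balls, a case outside [two_parameter_decrement]. *)
have [w1|w2] := leqP (size w) 1.
  case: w w1 w0 {wk uw} => [|x [|y w]] // _ _.
  rewrite !big_seq1 /= eqxx big_seq1 laplace_cpf_cons laplace_cpf_nil mulr1 addn0.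
  rewrite /eppf /= big_geq // big_seq1 addn0.
  have f0 : (sz x)`!%:R != 0 :> R by rewrite pnatr_eq0 -lt0n fact_gt0.
  rewrite divff // !mul1r -[in LHS](prednK (sz_gt0 x)).
  by rewrite (two_parameter_decrement_full alpha01 theta0 c_gt0 Phi0 PhiS) mulrC.
set N := sumn (map sz w).
(* [K] collects what does not depend on the first class. The sum over [x] will supply the missing
   last factor, [i = (size w).-1], and cancel the extra [N] in the denominator. *)
pose K : R := N`!%:R / (\prod_(x <- w) (sz x)`!)%:R
  * ((\prod_(1 <= i < (size w).-1) (theta + alpha * i%:R))
     / (N%:R * rising (1 + theta) N.-1) * \prod_(x <- w) rising (1 - alpha) (sz x).-1).
have num_neq0 n : rising (1 + theta) n != 0.
  by rewrite gt_eqF // rising_gt0 // ltr_wpDr.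
have N_gt0 : (0 < N)%N.
  by rewrite /N; case: (w) w0 => //= x w' _; rewrite addn_gt0 sz_gt0.
have N_neq0 : N%:R != 0 :> R by rewrite pnatr_eq0 -lt0n.
have E x : x \in w ->
    \sum_(v <- permutations (rem x w)) laplace_cpf Phi (sz x :: map sz v) =
    K * ((N%:R - (sz x)%:R) * alpha + (sz x)%:R * theta).
  move=> xw; have px := perm_to_rem xw.
  have sN : (sz x + sumn (map sz (rem x w)) = N)%N.
    by rewrite /N (perm_sumn (perm_map sz px)).
  have srem : size (rem x w) = (size w).-1 by rewrite size_rem.
  have rem0 : rem x w != [::] by rewrite -size_eq0 srem; lia.
  set r := sumn (map sz (rem x w)) in sN.
  have r_gt0 : (0 < r)%N.
    by rewrite /r; case: (rem x w) rem0 => //= y w' _; rewrite addn_gt0 sz_gt0.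
  have -> : \sum_(v <- permutations (rem x w)) laplace_cpf Phi (sz x :: map sz v) =
      decrement Phi N (sz x) *
      \sum_(v <- permutations (rem x w)) laplace_cpf Phi (map sz v).
    rewrite big_distrr /=; apply: eq_big_seq => v; rewrite mem_permutations => pv.
    by rewrite laplace_cpf_cons (perm_sumn (perm_map sz pv)) sN.
  rewrite IHk ?rem_uniq //; last by rewrite srem; lia.
  rewrite /K /eppf size_map srem -/r.
  rewrite !(perm_big _ px) !big_cons /= big_map natrM.
  have -> : decrement Phi N (sz x) = 'C(N, sz x)%:R * rising (1 - alpha) (sz x).-1
      * (r%:R * alpha + (sz x)%:R * theta) * rising (1 + theta) r.-1
      / (N%:R * rising (1 + theta) N.-1).
    have := two_parameter_decrement alpha01 theta0 c_gt0 PhiS r.-1 (sz x).-1.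
    rewrite !prednK // sN => ->; congr (_ / (_ * rising _ _)).
    move: (sz_gt0 x) r_gt0 sN; clear; lia.
  have -> : N%:R - (sz x)%:R = r%:R :> R by rewrite -sN natrD addrC addKr.
  have -> : N`!%:R = 'C(N, sz x)%:R * ((sz x)`!%:R * r`!%:R) :> R.
    by rewrite -!natrM -sN -[in r`!](addKn (sz x) r) bin_fact // leq_addr.
  have f0 : (sz x)`!%:R != 0 :> R by rewrite pnatr_eq0 -lt0n fact_gt0.
  have W0 : (\prod_(j <- rem x w) (sz j)`!)%:R != 0 :> R.
    by rewrite pnatr_eq0 -lt0n prodn_gt0 // => j; rewrite fact_gt0.
  move: f0 W0 N_neq0 (num_neq0 r.-1) (num_neq0 N.-1).
  set f := (sz x)`!%:R; set W := (_ : nat)%:R; set n := N%:R.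
  set u := rising (1 + theta) _; set v := rising (1 + theta) _.
  set F := (_ : nat)`!%:R.
  move: f W n u v => f W n u v f0 W0 n0 u0 v0.
  by field; rewrite f0 W0 n0 u0 v0.
(* The sizes add up to [N], so for k classes the linear factors add up to N ((k - 1) alpha +
   theta). *)
rewrite (eq_big_seq _ E) -big_distrr /=.
rewrite big_split /= -!mulr_suml sumrB.
have -> : \sum_(x <- w) (sz x)%:R = N%:R :> R by rewrite -natr_sum /N sumnE big_map.
rewrite big_const_seq count_predT iter_addr_0 /K /eppf size_map big_map -/N.
rewrite -(prednK (ltnW w2)) big_nat_recr /=; last by lia.
rewrite -[N%:R *+ _]mulr_natr.
have W0 : (\prod_(j <- w) (sz j)`!)%:R != 0 :> R.
  by rewrite pnatr_eq0 -lt0n prodn_gt0 // => j; rewrite fact_gt0.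
move: W0 N_neq0 (num_neq0 N.-1); set W := (_ : nat)%:R; set n := N%:R.
set v := rising _ _; set F := _`!%:R; move: W n v F => W n v F W0 n0 v0.
by field; rewrite W0 n0 v0.
Qed.

End TwoParameterOrderings.

Lemma two_parameter_generates (R : realType) (alpha theta c : R) (Phi : R -> R) :
  0 <= alpha <= 1 -> 0 <= theta -> 0 < c -> Phi 0 = 0 ->
  (forall n, Phi n.+1%:R =
     c * n.+1%:R * rising (1 + theta) n / rising (theta + 2 - alpha) n) ->
  generates (laplace_cpf Phi) alpha theta.
Proof.
move=> a01 t0 c0 P0 PS n P n0 PT.
have Pw : enum P \in permutations (enum P) by rewrite mem_permutations.
rewrite (two_parameter_lawE _ _ PT Pw) derived_lawE //.
have cP := is_composition_partition PT Pw; have /andP[/allP Pc /eqP sP] := cP.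
(* [sum_orderings_laplace] asks for positive sizes on the whole type, so the empty set, which is
   never a class, gets the dummy size 1. *)
pose sz (B : {set 'I_n}) := if B == finset.set0 then 1%N else #|B|.
have sz_gt0 B : (0 < sz B)%N by rewrite /sz; case: eqP => // /eqP; rewrite card_gt0.
have szE v : v \in permutations (enum P) -> [seq #|B| | B : {set 'I_n} <- v] = map sz v.
  rewrite mem_permutations => /perm_mem vP; apply/eq_in_map => B; rewrite vP mem_enum.
  by move=> /(partition_neq0 PT); rewrite /sz => /negPf ->.
rewrite (eq_big_seq (fun v => laplace_cpf Phi (map sz v))); last first.
  by move=> v /szE ->.
rewrite (sum_orderings_laplace a01 t0 c0 P0 PS sz_gt0) ?enum_uniq //; last first.
  by rewrite -size_eq0; move: sP; case: (enum P) => //= E; rewrite -E in n0.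
rewrite -(szE _ Pw) sP big_enum /=.
have -> : (\prod_(x in P) (sz x)`! = \prod_(B in P) (#|B|)`!)%N.
  by apply: eq_bigr => B /(partition_neq0 PT) /negPf B0; rewrite /sz B0.
have f0 : n`!%:R != 0 :> R by rewrite pnatr_eq0 -lt0n fact_gt0.
have W0 : (\prod_(B in P) (#|B|)`!)%:R != 0 :> R.
  by rewrite pnatr_eq0 -lt0n prodn_gt0 // => j; rewrite fact_gt0.
by field; rewrite f0 W0.
Qed.

(** * The Gamma function *)

Section GammaFunction.
Variable R : realType.
Implicit Types (a x y t : R).
Local Notation mu := (@lebesgue_measure R).

Definition gamma_integrand a t : R := t `^ (a - 1) * expR (- t).

(** Kept in the extended reals, so that the functional equation can be proved first and finiteness
    deduced from it. *)
Definition gamma_integral a : \bar R :=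
  (\int[mu]_(t in `]0%R, +oo[) (gamma_integrand a t)%:E)%E.

Lemma GammaE a : Gamma a = fine (gamma_integral a).
Proof. by []. Qed.

Lemma gamma_integrand_ge0 a t : 0 <= gamma_integrand a t.
Proof. by rewrite mulr_ge0 ?powR_ge0 ?expR_ge0. Qed.

Lemma is_derive_expRN t : is_derive t 1 (fun u => - expR (- u)) (expR (- t)).
Proof.
have -> : expR (- t) = - (expR (- t) * -1) by rewrite mulrN1 opprK.
by apply: is_deriveN; apply: is_derive1_comp.
Qed.

Lemma continuous_expRN : continuous (fun t => expR (- t) : R).
Proof.
move=> t; apply: continuous_comp; first exact: opp_continuous.
exact: continuous_expR.
Qed.

Lemma continuous_powRl a t : 0 < t -> {for t, continuous (fun u => u `^ a)}.
Proof.
move=> t0; apply/differentiable_continuous/derivable1_diffP.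
by apply: derivable_powR; rewrite in_itv/= andbT.
Qed.

Lemma measurable_gamma_integrand a (D : set R) :
  measurable_fun D (EFin \o gamma_integrand a).
Proof.
apply/measurable_EFinP/measurable_funTS; apply: measurable_funM.
  exact: measurable_powR.
by apply: continuous_measurable_fun; exact: continuous_expRN.
Qed.

Lemma within_continuous_powRl a x y : 0 < x -> x < y ->
  {within `[x, y], continuous (fun u => u `^ a)}.
Proof.
move=> x0 xy; apply: derivable_within_continuous => t; rewrite in_itv/= => /andP[xt _].
by apply: derivable_powR; rewrite in_itv/= andbT (lt_le_trans x0).
Qed.

Lemma gamma_integrand_by_parts a x y : 0 < x -> x < y ->
  (\int[mu]_(t in `[x, y]) (gamma_integrand (a + 1) t)%:E =
   (x `^ a * expR (- x) - y `^ a * expR (- y))%:E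
   + a%:E * \int[mu]_(t in `[x, y]) (gamma_integrand a t)%:E)%E.
Proof.
move=> x0 xy.
have cexp : {within `[x, y], continuous (fun t => expR (- t) : R)}.
  by apply: continuous_subspaceT; exact: continuous_expRN.
have int b : mu.-integrable `[x, y] (fun t => (gamma_integrand b t)%:E).
  apply: continuous_compact_integrable => //; first exact: segment_compact.
  by move=> t; apply: cvgM; [exact: within_continuous_powRl|exact: cexp].
have finI b : (\int[mu]_(t in `[x, y]) (gamma_integrand b t)%:E =
    (\int[mu]_(t in `[x, y]) gamma_integrand b t)%:E)%E.
  by rewrite /Rintegral fineK // integrable_fin_num.
rewrite !finI -EFinM -EFinD; congr _%:E.
have -> : \int[mu]_(t in `[x, y]) gamma_integrand (a + 1) t =
    \int[mu]_(t in `[x, y]) (t `^ a * expR (- t)).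
  by apply: eq_Rintegral => t _; rewrite /gamma_integrand addrK.
rewrite (@Rintegration_by_parts _ (fun t => t `^ a) (fun t => - expR (- t))
  (fun t => a * t `^ (a - 1)) (fun t => expR (- t)) x y) //.
- rewrite (_ : \int[mu]_(t in `[x, y]) _ =
      - a * \int[mu]_(t in `[x, y]) gamma_integrand a t).
    by ring.
  rewrite -RintegralZl //; last exact: int.
  apply: eq_Rintegral => t _.
  by rewrite /gamma_integrand; ring.
- move=> t; apply: cvgM; [exact: cvg_cst|exact: within_continuous_powRl].
- split.
  + move=> t; rewrite in_itv/= => /andP[xt _]; apply: derivable_powR.
    by rewrite in_itv/= andbT (lt_trans x0).
  + by apply: cvg_at_right_filter; apply: continuous_powRl.
  + by apply: cvg_at_left_filter; exact/continuous_powRl/(lt_trans x0 xy).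
- move=> t; rewrite in_itv/= => /andP[xt _]; apply: powR_derive1.
  by rewrite in_itv/= andbT (lt_trans x0).
- split.
  + by move=> t _; have [] := is_derive_expRN t.
  + by apply: cvg_at_right_filter; apply: cvgN; exact: continuous_expRN.
  + by apply: cvg_at_left_filter; apply: cvgN; exact: continuous_expRN.
- by move=> t _; rewrite derive1E; have [_ ->] := is_derive_expRN t.
Qed.

(** The offset 2 keeps the endpoints distinct already at [n = 0], as the integration by parts asks
    for [x < y]. *)
Definition gamma_cut (n : nat) : set R := `[n.+2%:R^-1, n.+2%:R].

Lemma gamma_integral_cvg a :
  (\int[mu]_(t in gamma_cut n) (gamma_integrand a t)%:E)%E
    @[n --> \oo] --> gamma_integral a.
Proof.
have -> : gamma_integral a =
    (\int[mu]_(t in \bigcup_n gamma_cut n) (gamma_integrand a t)%:E)%E.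
  rewrite /gamma_integral; congr integral; apply/seteqP; split => [t|t [n _]] /=.
    rewrite in_itv/= andbT => t0.
    pose n := maxn (Num.bound t) (Num.bound t^-1).
    have [tn tVn] : t <= n%:R /\ t^-1 <= n%:R.
      split; apply: ltW; apply: lt_le_trans.
      - exact: archi_boundP (ltW t0).
      - by rewrite ler_nat leq_maxl.
      - by apply: archi_boundP; rewrite invr_ge0 ltW.
      - by rewrite ler_nat leq_maxr.
    have n2 : (n%:R : R) <= n.+2%:R by rewrite ler_nat -addn2 leq_addr.
    exists n => //; rewrite /gamma_cut /= in_itv/= (le_trans tn n2) andbT.
    by rewrite invf_ple ?posrE // (le_trans tVn).
  rewrite /gamma_cut /= !in_itv/= andbT => /andP[nt _].
  by apply: lt_le_trans nt; rewrite invr_gt0.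
apply: ge0_nondecreasing_set_cvg_integral => //.
- move=> m n mn; apply/subsetPset => t; rewrite /gamma_cut /= !in_itv/= => /andP[h1 h2].
  have mn2 : (m.+2%:R : R) <= n.+2%:R by rewrite ler_nat.
  by rewrite (le_trans h2) // andbT (le_trans _ h1) // lef_pV2 ?posrE.
- by move=> n; exact: measurable_itv.
- by move=> n; exact: measurable_gamma_integrand.
- by move=> n t _; rewrite lee_fin gamma_integrand_ge0.
Qed.

(** With [k] an integer above [a], x^a <= x^k for x >= 1, and the term of degree [k.+1] of the
    exponential series leaves a factor 1/x. *)
Lemma powR_expRN_le a n (k := Num.bound a) : 0 < a ->
  n.+1%:R `^ a * expR (- n.+1%:R) <= k.+1`!%:R * n.+1%:R^-1 :> R.
Proof.
move=> a0; have n1 : 1 <= n.+1%:R :> R by rewrite ler1n.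
have n0 : 0 < n.+1%:R :> R by [].
have le_k : n.+1%:R `^ a <= n.+1%:R ^+ k :> R.
  by rewrite -powR_mulrn ?ler0n // ler_powR // ltW // archi_boundP // ltW.
rewrite expRN ler_pdivrMr ?expR_gt0 // mulrAC ler_pdivlMr //.
have := expR_ge1Dxn k (ltW n0).
move=> /(le_trans _) h; apply: (@le_trans _ _ (n.+1%:R ^+ k.+1)).
  by rewrite exprSr ler_wpM2r.
rewrite -ler_pdivrMl; last by rewrite ltr0n fact_gt0.
by rewrite mulrC h // lerDr.
Qed.

(** These are the boundary terms of the integration by parts: near 0 the power vanishes because a >
    0, near infinity the exponential wins. *)
Lemma boundary_cvg0 a : 0 < a ->
  (n.+2%:R^-1 `^ a * expR (- n.+2%:R^-1) - n.+2%:R `^ a * expR (- n.+2%:R) : R)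
    @[n --> \oo] --> (0 : R).
Proof.
move=> a0; rewrite -[X in _ --> X](subr0 0); apply: cvgB.
  apply: (@squeeze_cvgr _ _ _ _ (fun=> 0) (fun n => (n.+2%:R^-1 : R) `^ a)).
  - near=> n; apply/andP; split; first by rewrite mulr_ge0 ?powR_ge0 ?expR_ge0.
    by rewrite ler_piMr ?powR_ge0 // expR_le1 oppr_le0 invr_ge0.
  - exact: cvg_cst.
  (* [powR_cvg0] is a limit from the right of 0, which applies because every [n.+2%:R^-1] is
     positive. *)
  apply: (@cvg_comp _ _ _ _ _ _ (0 : R)^'+ _ _ (powR_cvg0 a0)).
  move=> A A0; have h0 : (n.+2%:R^-1 : R) @[n --> \oo] --> (0 : R).
    by have := @cvg_harmonic R; rewrite -cvg_shiftS.
  have H : \forall n \near \oo, 0 < (n.+2%:R^-1 : R) -> A (n.+2%:R^-1) := h0 _ A0.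
  suff : \forall n \near \oo, A (n.+2%:R^-1) by [].
  by apply: filterS H => n; apply; rewrite invr_gt0.
apply: (@squeeze_cvgr _ _ _ _ (fun=> 0)
  (fun n => (Num.bound a).+1`!%:R * harmonic n.+1)).
- near=> n; apply/andP; split; first by rewrite mulr_ge0 ?powR_ge0 ?expR_ge0.
  exact: powR_expRN_le.
- exact: cvg_cst.
rewrite -[X in _ --> X](mulr0 ((Num.bound a).+1`!%:R)).
apply: cvgM; first exact: cvg_cst.
by have := @cvg_harmonic R; rewrite -cvg_shiftS.
Unshelve. all: by end_near. Qed.

Lemma gamma_integralS a : 0 < a -> gamma_integral (a + 1) = (a%:E * gamma_integral a)%E.
Proof.
move=> a0; rewrite -(cvg_lim _ (@gamma_integral_cvg (a + 1))) //.
apply/cvg_lim => //.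
have parts n := @gamma_integrand_by_parts a n.+2%:R^-1 n.+2%:R.
rewrite /gamma_cut; under eq_fun => n.
  rewrite parts; [|by rewrite invr_gt0|]; last first.
    by apply: (@lt_trans _ _ 1); rewrite ?invf_lt1 ?ltr1n.
  over.
rewrite -[(a%:E * gamma_integral a)%E]add0e; apply: cvgeD => //.
  by apply: cvg_EFin; [exact: nearW|exact: boundary_cvg0].
by apply: cvgeZl => //; exact: gamma_integral_cvg.
Qed.

End GammaFunction.

(** * Finiteness, positivity and functional equation of Gamma *)

Section GammaValues.
Variable R : realType.
Implicit Types (a b t alpha theta : R).
Local Notation mu := (@lebesgue_measure R).

Lemma powR_le1D a t : 1 <= a <= 2 -> 0 < t -> t `^ (a - 1) <= 1 + t.
Proof.
move=> /andP[a1 a2] t0; have [t1|/ltW t1] := leP t 1.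
  apply: (@le_trans _ _ 1); last by rewrite lerDl ltW.
  by rewrite -[leRHS](powRr0 t) ger_powR ?t0 // subr_ge0.
apply: (@le_trans _ _ t); last by rewrite lerDr.
have h : a - 1 <= 1 by lra.
by have := ler_powR t1 h; rewrite powRr1 // ltW.
Qed.

(** Since 1 + t <= 2 (1 + t/2) <= 2 exp(t/2), half of the exponential decay absorbs the power. The
    constant 4 is this 2 divided by the rate 1/2 of the density. *)
Lemma gamma_integrand_le a t : 1 <= a <= 2 -> 0 < t ->
  gamma_integrand a t <= 4 * exponential_pdf (2^-1) t.
Proof.
move=> a12 t0; rewrite exponential_pdfE ?(ltW t0) // /gamma_integrand.
have e0 := expR_gt0 (2^-1 * t).
have e1 : 1 + 2^-1 * t <= expR (2^-1 * t) by apply: expR_ge1Dx.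
have -> : - t = - 2^-1 * t + - 2^-1 * t by lra.
rewrite expRD mulNr expRN !mulrA ler_wpM2r ?invr_ge0 ?(ltW e0) //.
rewrite ler_pdivrMr // (le_trans (powR_le1D a12 t0)) //.
by nra.
Qed.

Lemma gamma_integral_lty a : 1 <= a <= 2 -> (gamma_integral a < +oo)%E.
Proof.
move=> a12; rewrite ltey_eq; apply/orP; left.
apply: integrable_fin_num => //.
have half0 : 0 < 2^-1 :> R by [].
apply: (@le_integrable _ _ _ mu _ _ _
  (fun t => 4%:E * (exponential_pdf 2^-1 t)%:E)%E) => //.
- exact: measurable_gamma_integrand.
- move=> t; rewrite /= in_itv/= andbT => t0.
  rewrite lee_fin !ger0_norm ?gamma_integrand_ge0 ?mulr_ge0 ?exponential_pdf_ge0 //.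
  exact: gamma_integrand_le.
apply: integrableZl => //; apply: integrableS (integrable_exponential_pdf half0) => //.
Qed.

Lemma gamma_integral_gt0 a : 1 <= a <= 2 -> (0 < gamma_integral a)%E.
Proof.
move=> /andP[a1 a2]; apply: (@lt_le_trans _ _ (expR (- 2))%:E).
  by rewrite lte_fin expR_gt0.
have -> : ((expR (- 2))%:E = \int[mu]_(t in `[1%R, 2%R]) cst (expR (- 2))%:E t)%E.
  rewrite integral_cst //= lebesgue_measure_itv /= lte_fin ltr1n /=.
  by rewrite -EFinB -EFinM; congr _%:E; ring.
apply: (@le_trans _ _ (\int[mu]_(t in `[1%R, 2%R]) (gamma_integrand a t)%:E)%E).
  apply: ge0_le_integral => //.
  - by move=> t _; rewrite lee_fin expR_ge0.
  - exact: measurable_gamma_integrand.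
  move=> t; rewrite /= in_itv/= lee_fin => /andP[t1 t2].
  rewrite -[leLHS]mul1r ler_pM ?expR_ge0 //; last by rewrite ler_expR lerN2.
  by rewrite -[leLHS](powRr0 t) ler_powR // subr_ge0.
apply: ge0_subset_integral => //.
- exact: measurable_gamma_integrand.
- by move=> t _; rewrite lee_fin gamma_integrand_ge0.
- by move=> t; rewrite /= !in_itv/= andbT => /andP[t1 _]; apply: lt_le_trans t1.
Qed.

(** The functional equation transports the bounds both ways: a <= 1 is moved up into [1, 2], and a >
    1 is lowered by 1. *)
Lemma gamma_integral_bounds a : 0 < a -> (0 < gamma_integral a < +oo)%E.
Proof.
have step (b : R) : 0 < b ->
    (0 < gamma_integral (b + 1) < +oo)%E = (0 < gamma_integral b < +oo)%E.
  move=> b0; rewrite gamma_integralS //; case: (gamma_integral b) => [r| |].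
  - by rewrite -EFinM !lte_fin !ltry pmulr_rgt0.
  - by rewrite gt0_muley ?lte_fin // ltxx.
  - by rewrite gt0_muleNy ?lte_fin.
have base (b : R) : 1 <= b <= 2 -> (0 < gamma_integral b < +oo)%E.
  by move=> b12; rewrite gamma_integral_gt0 // gamma_integral_lty.
move=> a0; have := archi_boundP (ltW a0).
move: (Num.bound a) => n; elim: n a a0 => [|n IHn] a a0; first by rewrite ltNge ltW.
have [a1 _|a1 an] := leP a 1.
  by rewrite -step // base //; lra.
rewrite -(subrK 1 a) step ?subr_gt0 // IHn ?subr_gt0 //.
by rewrite ltrBlDr natr1.
Qed.

Lemma Gamma_gt0 a : 0 < a -> 0 < Gamma a.
Proof.
by move=> /gamma_integral_bounds; rewrite GammaE => /andP[h1 h2]; rewrite fine_gt0 ?h1.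
Qed.

Lemma GammaS a : 0 < a -> Gamma (a + 1) = a * Gamma a.
Proof.
move=> a0; rewrite !GammaE gamma_integralS // fineM //.
have /andP[h1 h2] := gamma_integral_bounds a0.
by rewrite ge0_fin_numE ?ltW.
Qed.

Lemma Gamma_rising a n : 0 < a -> Gamma (a + n%:R) = Gamma a * rising a n.
Proof.
move=> a0; elim: n => [|n IHn]; first by rewrite addr0 rising0 mulr1.
rewrite -natr1 addrA GammaS ?ltr_wpDr // IHn risingS.
by ring.
Qed.

(** This provides the constant [c = Beta (1 - alpha) (1 + theta)]; the rising factorials are based
    at 1 + theta because theta may be 0. *)
Lemma Phi_betaS alpha theta n : alpha < 1 -> 0 <= theta ->
  Phi_beta alpha theta n.+1%:R =
  Beta (1 - alpha) (1 + theta) * n.+1%:R * rising (1 + theta) n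
  / rising (theta + 2 - alpha) n.
Proof.
move=> a1 t0; rewrite /Phi_beta /Beta.
have -> : n.+1%:R + theta = 1 + theta + n%:R by rewrite -natr1; ring.
have -> : 1 - alpha + (1 + theta + n%:R) = theta + 2 - alpha + n%:R by ring.
have -> : 1 - alpha + (1 + theta) = theta + 2 - alpha by ring.
rewrite !Gamma_rising; [|lra..].
have g0 : Gamma (theta + 2 - alpha) != 0 by rewrite gt_eqF // Gamma_gt0; lra.
have r0 : rising (theta + 2 - alpha) n != 0 by rewrite gt_eqF // rising_gt0; lra.
by field; rewrite g0 r0.
Qed.

Lemma Beta_gt0 a b : 0 < a -> 0 < b -> 0 < Beta a b.
Proof. by move=> a0 b0; rewrite /Beta divr_gt0 ?mulr_gt0 ?Gamma_gt0 ?addr_gt0. Qed.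

End GammaValues.

(** * Partition structures of regenerative compositions *)

Lemma is_composition_ones n : is_composition n (nseq n 1%N).
Proof.
rewrite /is_composition sumn_nseq mul1n eqxx andbT.
by apply/allP => m /nseqP[->].
Qed.

(** * The partition formula at the shapes used below *)

Section EppfValues.
Variables (R : realType) (alpha theta : R).

Lemma big_ones_rising n : \prod_(m <- nseq n 1%N) rising (1 - alpha) m.-1 = 1.
Proof. by rewrite big_nseq; elim: n => //= n ->; rewrite rising0 mul1r. Qed.

Lemma eppf_ones n : eppf alpha theta (nseq n 1%N) =
  (\prod_(1 <= i < n) (theta + alpha * i%:R)) / rising (1 + theta) n.-1.
Proof. by rewrite /eppf size_nseq sumn_nseq mul1n big_ones_rising mulr1. Qed.

Lemma eppf_cons_ones m n : eppf alpha theta (m :: nseq n 1%N) =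
  (\prod_(1 <= i < n.+1) (theta + alpha * i%:R)) / rising (1 + theta) (m + n).-1
  * rising (1 - alpha) m.-1.
Proof.
by rewrite /eppf /= size_nseq sumn_nseq mul1n big_cons big_ones_rising mulr1.
Qed.

Lemma eppf_one_block n :
  eppf alpha theta [:: n] = rising (1 - alpha) n.-1 / rising (1 + theta) n.-1.
Proof. by rewrite /eppf /= big_geq // big_seq1 addn0 mul1r mulrC. Qed.

Lemma eppf_two_blocks a b : eppf alpha theta [:: a; b] =
  (theta + alpha) / rising (1 + theta) (a + b).-1
  * (rising (1 - alpha) a.-1 * rising (1 - alpha) b.-1).
Proof. by rewrite /eppf /= big_nat1 mulr1 big_cons big_seq1 addn0. Qed.

End EppfValues.

(** * Compositions that generate the two-parameter partitions *)

Section Generation.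
Variables (R : realType) (p : seq nat -> R) (alpha theta : R).
Hypothesis p_struct : regenerative_composition_structure p.
Hypothesis p_gen : generates p alpha theta.

Let p_ge0 n l : (0 < n)%N -> is_composition n l -> 0 <= p l.
Proof. by case: p_struct => -[h _] _; exact: h. Qed.

Let p_sum1 n : (0 < n)%N -> \sum_(l <- compositions n) p l = 1.
Proof. by case: p_struct => -[_ [h _]] _; exact: h. Qed.

(** Regeneration without conditioning: if the first part cannot be [m], then [p (m :: l)] is one of
    the nonnegative terms of a zero sum. *)
Lemma regenerative_cons n m l : (0 < m < n)%N -> is_composition (n - m) l ->
  p (m :: l) = first_part p n m * p l.
Proof.
move=> mn cl; have [_ reg] := p_struct.
have cml : is_composition n (m :: l).
  by rewrite is_composition_cons cl andbT; lia.
have [F0|F0] := eqVneq (first_part p n m) 0; last first.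
  by rewrite -(reg _ _ _ mn cl F0) mulrC divfK.
rewrite F0 mul0r; apply/le_anti; rewrite (p_ge0 _ cml) ?andbT; last by lia.
rewrite -F0 /first_part big_mkcond /= (bigD1_seq (m :: l)) ?compositions_uniq
  ?mem_compositions //=.
rewrite eqxx lerDl big_seq_cond; apply: sumr_ge0 => k.
rewrite mem_compositions => /andP[ck _]; case: ifP => // _.
by apply: (p_ge0 _ ck); lia.
Qed.

(** The identity labelling of [l] provides a partition with class sizes [l], so every composition
    can be tested against the formula. *)
Lemma generates_orderings n l : (0 < n)%N -> is_composition n l ->
  exists w : seq {set 'I_n},
    [/\ uniq w, [seq #|B| | B : {set 'I_n} <- w] = l &
     (\prod_(m <- l) m`!)%:R / n`!%:R *
     (\sum_(v <- permutations w) p [seq #|B| | B : {set 'I_n} <- v]) =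
     eppf alpha theta l].
Proof.
move=> n0 cl; pose P := labelled_partition l (1%g : 'S_n).
have PT : finset.partition P [set: 'I_n]%SET by exact: preim_partitionP.
pose w := blocks l (1%g : 'S_n).
have wP : w \in permutations (enum P) by rewrite -labelled_partition_eq.
have pw : perm_eq w (enum P) by rewrite -mem_permutations.
exists w; rewrite blocks_uniq // map_card_blocks //; split=> //.
rewrite -[in RHS](map_card_blocks 1%g cl) -(two_parameter_lawE _ _ PT wP).
rewrite -(p_gen n0 PT) derived_lawE //; congr (_%:R / _ * _).
  rewrite -[in LHS](map_card_blocks 1%g cl) big_map.
  by rewrite (perm_big _ pw) big_enum.
exact/perm_big/perm_permutations.
Qed.

Lemma eppf_ge0 n l : (0 < n)%N -> is_composition n l -> 0 <= eppf alpha theta l.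
Proof.
move=> n0 cl; have [w [uw wl <-]] := generates_orderings n0 cl.
rewrite mulr_ge0 // big_seq sumr_ge0 // => v; rewrite mem_permutations => vw.
apply: (p_ge0 n0); have /andP[l1 /eqP ls] := cl.
have pv : perm_eq [seq #|B| | B : {set 'I_n} <- v] l by rewrite -wl perm_map.
by apply/andP; rewrite (perm_all _ pv) (perm_sumn pv) l1 ls.
Qed.

(** The formula is a positive multiple of a sum of nonnegative terms, one of which is [p l]. *)
Lemma eppf_eq0 n l : (0 < n)%N -> is_composition n l ->
  eppf alpha theta l = 0 -> p l = 0.
Proof.
move=> n0 cl; have [w [uw wl <-]] := generates_orderings n0 cl.
have K0 : (\prod_(m <- l) m`!)%:R / n`!%:R != 0 :> R.
  rewrite mulf_neq0 // ?invr_eq0 pnatr_eq0 -lt0n ?fact_gt0 //.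
  by rewrite prodn_gt0 // => m; rewrite fact_gt0.
move=> /eqP; rewrite mulf_eq0 (negPf K0) /= => /eqP S0.
apply/le_anti; rewrite (p_ge0 n0 cl) andbT -S0.
rewrite (bigD1_seq w) ?permutations_uniq ?mem_permutations //= wl lerDl.
rewrite big_seq_cond sumr_ge0 // => v; rewrite mem_permutations => /andP[vw _].
apply: (p_ge0 n0); have /andP[l1 /eqP ls] := cl.
have pv : perm_eq [seq #|B| | B : {set 'I_n} <- v] l by rewrite -wl perm_map.
by apply/andP; rewrite (perm_all _ pv) (perm_sumn pv) l1 ls.
Qed.

(** All n! orderings have the same sizes, which cancels the factor 1/n!. *)
Lemma generates_ones n : (0 < n)%N ->
  p (nseq n 1%N) = eppf alpha theta (nseq n 1%N).
Proof.
move=> n0; have [w [uw wl <-]] := generates_orderings n0 (is_composition_ones n).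
have sw : size w = n by rewrite -[RHS](size_nseq n 1%N) -wl size_map.
rewrite big_nseq (_ : iter _ _ _ = 1%N); last by elim: (n) => //= k ->.
rewrite (eq_big_seq (fun=> p (nseq n 1%N))); last first.
  move=> v; rewrite mem_permutations => vw; congr p.
  have pv : perm_eq [seq #|B| | B : {set 'I_n} <- v] (nseq n 1%N).
    by rewrite -wl perm_map.
  have /all_pred1P -> : all (pred1 1%N) [seq #|B| | B : {set 'I_n} <- v].
    by rewrite (perm_all _ pv) all_nseq orbT.
  by rewrite (perm_size pv) size_nseq.
rewrite big_const_seq count_predT iter_addr_0 size_permutations // sw.
have n1 : n`!%:R != 0 :> R by rewrite pnatr_eq0 -lt0n fact_gt0.
by rewrite -[X in _ * X]mulr_natr mulr1n mul1r mulrCA mulVf // mulr1.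
Qed.

Lemma generates_one_block n : (0 < n)%N -> p [:: n] = eppf alpha theta [:: n].
Proof.
move=> n0; have c1 : is_composition n [:: n] by rewrite /is_composition /= n0 addn0 eqxx.
have [[|B [|C w]] [uw [] //= wl <-]] := generates_orderings n0 c1.
have n1 : n`!%:R != 0 :> R by rewrite pnatr_eq0 -lt0n fact_gt0.
by rewrite !big_seq1 divff // mul1r /= wl.
Qed.

Lemma generates_two_blocks a b : (0 < a)%N -> (0 < b)%N ->
  p [:: a; b] + p [:: b; a] =
  (a + b)`!%:R / (a`! * b`!)%:R * eppf alpha theta [:: a; b].
Proof.
move=> a0 b0; have c2 : is_composition (a + b) [:: a; b].
  by rewrite /is_composition /= a0 b0 addn0 eqxx.
have ab0 : (0 < a + b)%N by rewrite addn_gt0 a0.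
have [[|B [|C [|D w]]] [uw //= [Ba Cb] <-]] := generates_orderings ab0 c2.
have f0 m : m`!%:R != 0 :> R by rewrite pnatr_eq0 -lt0n fact_gt0.
rewrite (perm_big _ (permutationsE _)) // big_allpairs_dep.
rewrite undup_id // !big_cons !big_nil /= !eqxx.
move: uw; rewrite /= inE andbT => /negPf BC; rewrite BC.
rewrite !big_seq1 /= Ba Cb !addr0 muln1 natrM.
by field; rewrite !f0.
Qed.

(* All laws of the n-th level vanish when the denominator does, as x / 0 = 0. *)
Lemma rising_theta_neq0 n : rising (1 + theta) n != 0.
Proof.
apply/eqP => r0; have := p_sum1 (ltn0Sn n); rewrite big_seq big1.
  by move/eqP; rewrite eq_sym oner_eq0.
move=> l; rewrite mem_compositions => cl; apply: (eppf_eq0 (ltn0Sn n) cl).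
by have /andP[_ /eqP ls] := cl; rewrite /eppf ls r0 invr0 mulr0 mul0r.
Qed.

End Generation.

(** * Excluding parameters by signs *)

Section Nonexistence.
Variables (R : realType) (p : seq nat -> R) (alpha theta : R).
Hypothesis p_struct : regenerative_composition_structure p.
Hypothesis p_gen : generates p alpha theta.

Lemma theta_nat_neq0 n : (0 < n)%N -> theta + n%:R != 0.
Proof.
case: n => // n _; apply: contra_neq (rising_theta_neq0 p_struct p_gen n.+1).
rewrite risingS => e; have -> : 1 + theta + n%:R = theta + n.+1%:R.
  by rewrite -natr1; ring.
by rewrite e mulr0.
Qed.

(** Otherwise y / x = s / t would be negative. *)
Let sign_ratio_eq0 (x y t s : R) : 0 < t -> s < 0 -> 0 <= x -> 0 <= y ->
  y * t = x * s -> x = 0.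
Proof.
move=> t0 s0 x0 y0 e; apply/le_anti; rewrite x0 andbT.
by rewrite -(nmulr_lge0 _ s0) -e mulr_ge0 // ltW.
Qed.

Lemma not_generated_theta_ltN1 :
  theta < -1 -> 1 < alpha -> theta + alpha < 0 -> False.
Proof.
move=> t1 a1 ta0; have r0 := rising_theta_neq0 p_struct p_gen.
have ex : exists n, 0 <= n%:R + theta.
  exists (Num.bound (- theta)); rewrite -lerBlDr sub0r ltW // archi_boundP //; lra.
case: (ex_minnP ex) => -[|[|n]] h min_n; [lra|lra|].
have hn : theta + n.+2%:R > 0.
  by rewrite lt_neqAle eq_sym theta_nat_neq0 // addrC.
have hr : rising (1 + theta) n.+2 = rising (1 + theta) n.+1 * (theta + n.+2%:R).
  by rewrite risingS -!natr1; congr (_ * _); ring.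
move: (r0 n.+1) (lt0r_neq0 hn) => rn tn.
(* The ratio of (2,1,...,1) to (1,...,1), with [n.+2] classes each, is (1 - alpha) / (theta + n + 2)
   < 0, so the latter vanishes and one factor of its numerator is 0. *)
have [i ti] : exists i, theta + alpha * i.+1%:R = 0.
  have c1 := is_composition_ones n.+2.
  have c2 : is_composition n.+3 (2 :: nseq n.+1 1%N).
    by rewrite is_composition_cons /= (is_composition_ones n.+1).
  have : eppf alpha theta (nseq n.+2 1%N) = 0.
    apply: (@sign_ratio_eq0 _ (eppf alpha theta (2 :: nseq n.+1 1%N)) _ (1 - alpha) hn).
    - by rewrite subr_lt0.
    - exact: (eppf_ge0 p_struct p_gen _ c1).
    - exact: (eppf_ge0 p_struct p_gen _ c2).
    rewrite eppf_cons_ones eppf_ones !addSn add0n !PeanoNat.Nat.pred_succ hr.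
    rewrite (risingS (1 - alpha) 0) rising0 mul1r addr0.
    by field; rewrite rn -natrD tn.
  rewrite eppf_ones => /eqP; rewrite mulf_eq0 invr_eq0 (negPf (r0 _)) orbF.
  rewrite prodf_seq_eq0 => /hasP[[|i] ]; rewrite mem_index_iota //= => _ /eqP ti.
  by exists i.
(* Likewise (n+2,1) differs from (n+2) by the negative factor (theta + alpha) / (theta + n + 2). *)
have [j aj] : exists j : nat, 1 - alpha + j%:R = 0.
  have c1 : is_composition n.+2 [:: n.+2] by rewrite /is_composition /= addn0 eqxx.
  have c2 : is_composition n.+3 [:: n.+2; 1%N] by rewrite /is_composition /= addn0 addn1 eqxx.
  have : eppf alpha theta [:: n.+2] = 0.
    apply: (@sign_ratio_eq0 _ (eppf alpha theta [:: n.+2; 1%N]) _ (theta + alpha) hn) => //.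
    - exact: (eppf_ge0 p_struct p_gen _ c1).
    - exact: (eppf_ge0 p_struct p_gen _ c2).
    rewrite eppf_two_blocks eppf_one_block addn1 !PeanoNat.Nat.pred_succ hr rising0.
    by field; rewrite rn -natrD tn.
  rewrite eppf_one_block => /eqP; rewrite mulf_eq0 invr_eq0 (negPf (r0 _)) orbF.
  by rewrite /rising => /prodf_eq0[j _ /eqP aj]; exists j.
(* Now alpha = j + 1 and theta = - (i + 1) alpha, a negative integer. *)
have /eqP := @theta_nat_neq0 (i.+1 * j.+1) isT; apply.
rewrite -ti natrM -[j.+1%:R]natr1; have -> : alpha = 1 + j%:R by lra.
by ring.
Qed.

Lemma not_generated_theta_lt0 :
  -1 < theta < 0 -> 0 < theta + alpha -> alpha < 1 -> False.
Proof.
move=> /andP[t1 t0] ta a1.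
have t1' : 0 < 1 + theta by lra.
have nt0 : 0 < - theta by lra.
have a1' : 0 < 1 - alpha by lra.
have an0 : 0 <= alpha / - theta by rewrite divr_ge0 ?ltW //; lra.
have [k hk] : exists k : nat, alpha + k.+1%:R * theta < 0.
  exists (Num.bound (alpha / - theta)).
  by have := archi_boundP an0; rewrite ltr_pdivrMr // -natr1; lra.
have D0 : 0 < 1 + theta + k%:R by rewrite ltr_wpDr.
have ones0 : 0 < eppf alpha theta (nseq k.+1 1%N).
  rewrite eppf_ones divr_gt0 ?rising_gt0 //.
  rewrite big_nat_cond prodr_gt0 // => i /andP[/andP[i1 _] _].
  have i1' : 1 <= i%:R :> R by rewrite ler1n.
  by nra.
(* Runs of singletons have positive probability, so removing the first one determines q(k+2:1), and
   with it the order (1,k+1) of the shape {k+1,1}. *)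
have Q : first_part p k.+2 1 = (theta + alpha * k.+1%:R) / (1 + theta + k%:R).
  apply: (mulIf (lt0r_neq0 ones0)); rewrite -{1}(generates_ones p_gen) //.
  have c1 : is_composition (k.+2 - 1) (nseq k.+1 1%N) by rewrite subn1 is_composition_ones.
  rewrite -(regenerative_cons p_struct _ c1) // (generates_ones p_gen (ltn0Sn k.+1)).
  rewrite !eppf_ones !PeanoNat.Nat.pred_succ big_nat_recr //= risingS.
  by field; rewrite !lt0r_neq0 // rising_gt0.
have := generates_two_blocks p_gen (ltn0Sn k) (ltn0Sn 0).
have ck : is_composition k.+1 [:: k.+1] by rewrite /is_composition /= addn0 eqxx.
have ck' : is_composition (k.+2 - 1) [:: k.+1] by rewrite subn1.
rewrite (regenerative_cons p_struct (n := k.+2) _ ck') // Q.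
rewrite (generates_one_block p_gen) // addn1 (_ : 1`! = 1)%N // muln1 factS natrM.
have p0 : 0 <= p [:: k.+1; 1%N].
  case: p_struct => -[h _] _; apply: (h k.+2) => //.
  by rewrite /is_composition /= addn0 addn1 eqxx.
have f0 : (k.+1)`!%:R != 0 :> R by rewrite pnatr_eq0 -lt0n fact_gt0.
rewrite mulfK // eppf_one_block eppf_two_blocks addn1
  !PeanoNat.Nat.pred_succ rising0 mulr1 risingS.
have e0 : 0 < rising (1 - alpha) k / rising (1 + theta) k.
  by rewrite divr_gt0 ?rising_gt0.
(* The other order is left with (k+2) (theta + alpha) - (theta + (k+1) alpha) = alpha + (k+1) theta,
   negative by the choice of [k]. *)
move=> E; have : p [:: k.+1; 1%N] = (alpha + k.+1%:R * theta) *
   (rising (1 - alpha) k / rising (1 + theta) k / (1 + theta + k%:R)).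
  apply: (addIr ((theta + alpha * k.+1%:R) / (1 + theta + k%:R) *
     (rising (1 - alpha) k / rising (1 + theta) k))); rewrite E -!natr1.
  by field; rewrite !lt0r_neq0 // rising_gt0.
move: p0 => /[swap] ->; apply/negP; rewrite -ltNge.
by rewrite nmulr_rlt0 // divr_gt0.
Qed.

Lemma not_generated_alpha_lt0 : 0 < theta -> 0 < theta + alpha -> alpha < 0 -> False.
Proof.
move=> t0 ta a0; have r0 n : 0 < rising (1 + theta) n by rewrite rising_gt0 //; lra.
have ra0 n : 0 < rising (1 - alpha) n by rewrite rising_gt0 //; lra.
have ex : exists n, theta + alpha * n%:R <= 0.
  exists (Num.bound (theta / - alpha)).
  have := archi_boundP (divr_ge0 (ltW t0) _ : 0 <= theta / - alpha).
  rewrite oppr_ge0 ltW // => /(_ isT); rewrite ltr_pdivrMr ?oppr_gt0 // => h.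
  by lra.
case: (ex_minnP ex) => -[|[|n]] h min_n; [lra|lra|].
have lt0 i : (i < n.+2)%N -> 0 < theta + alpha * i%:R.
  by rewrite ltNge => iN; apply/negP => /min_n; rewrite leqNgt iN.
have prod0 : 0 < \prod_(1 <= i < n.+2) (theta + alpha * i%:R).
  by rewrite big_nat_cond prodr_gt0 // => i /andP[/andP[_ iN] _]; apply: lt0.
(* The probability of [n.+3] singletons is nonnegative and all earlier factors are positive, so the
   first factor that is not positive must be 0. *)
have e0 : theta + alpha * n.+2%:R = 0.
  have := eppf_ge0 p_struct p_gen (ltn0Sn _) (is_composition_ones n.+3).
  rewrite eppf_ones big_nat_recr //= pmulr_lge0 ?invr_gt0 // pmulr_rge0 // => e.
  by apply/le_anti; rewrite h.
have cN : is_composition (n.+2 + n.+2) (n.+2 :: nseq n.+2 1%N).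
  by rewrite is_composition_cons addKn is_composition_ones leq_addr.
have eN : eppf alpha theta (n.+2 :: nseq n.+2 1%N) = 0.
  by rewrite eppf_cons_ones big_nat_recr //= e0 mulr0 !mul0r.
have := eppf_eq0 p_struct p_gen (ltn0Sn _) cN eN.
rewrite (regenerative_cons p_struct (n := n.+2 + n.+2)) ?addKn
  ?is_composition_ones //; last by lia.
rewrite (generates_ones p_gen) // => /eqP; rewrite mulf_eq0 => /orP[/eqP F0|]; last first.
  by rewrite eppf_ones gt_eqF // divr_gt0.
have := generates_two_blocks p_gen (ltn0Sn n.+1) (ltn0Sn n.+1).
rewrite (regenerative_cons p_struct (n := n.+2 + n.+2)) ?addKn //; last 2 first.
- by lia.
- by rewrite /is_composition /= addn0 eqxx.
rewrite F0 mul0r addr0 => /esym/eqP.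
rewrite gt_eqF // mulr_gt0 //.
by rewrite eppf_two_blocks !mulr_gt0 ?invr_gt0.
Qed.

(** Once alpha = 1 and theta = - alpha are set aside, the sign conditions at n = 2 become strict;
    the signs of 1 + theta, theta and alpha then separate the three excluded regions. *)
Lemma generated_parameters : ~ degenerate alpha theta ->
  (0 <= alpha < 1 /\ 0 <= theta) \/ (alpha = 1 /\ 0 <= theta).
Proof.
move=> ndeg.
have t1 : 1 + theta != 0.
  by have := rising_theta_neq0 p_struct p_gen 1; rewrite risingS rising0 mul1r addr0.
have ta : theta + alpha != 0.
  by apply/eqP => /eqP; rewrite addr_eq0 => /eqP e; apply: ndeg; left.
have [a1|a1] := eqVneq alpha 1.
  have [t0|t0] := leP 0 theta; first by right.
  by case: ndeg; right.
have e1 := eppf_ge0 p_struct p_gen (isT : (0 < 2)%N) (isT : is_composition 2 [:: 2]).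
have e2 := eppf_ge0 p_struct p_gen (isT : (0 < 2)%N) (isT : is_composition 2 [:: 1; 1]%N).
move: e1 e2; rewrite eppf_one_block eppf_two_blocks /=.
rewrite !risingS !rising0 !addr0 !mul1r mulr1.
have [t1neg|t1pos|/eqP] := ltgtP (1 + theta) 0; last by rewrite (negPf t1).
  rewrite !ler_ndivlMr // !mul0r => a2 ta2; exfalso; apply: not_generated_theta_ltN1.
  - by lra.
  - by rewrite lt_neqAle eq_sym a1 /=; lra.
  - by rewrite lt_neqAle ta.
rewrite !ler_pdivlMr // !mul0r => a2 ta2.
have a3 : alpha < 1 by rewrite lt_neqAle a1 /=; lra.
have ta3 : 0 < theta + alpha by rewrite lt_neqAle eq_sym ta.
have [t0|t0] := leP 0 theta; last first.
  by exfalso; apply: not_generated_theta_lt0 => //; lra.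
have [a0|a0] := leP 0 alpha; first by left; split=> //; apply/andP.
by exfalso; apply: not_generated_alpha_lt0 => //; lra.
Qed.

End Nonexistence.

(** * The limiting case alpha = 1 *)

Section SingletonLimit.
Variables (R : realType) (theta : R).
Hypothesis theta0 : 0 <= theta.

(** At alpha = 1 the two rising factorials coincide, so the pure drift is an instance of the closed
    forms with [c = 1]. *)
Let id_PhiS n :
  n.+1%:R = 1 * n.+1%:R * rising (1 + theta) n / rising (theta + 2 - 1) n :> R.
Proof.
have -> : theta + 2 - 1 = 1 + theta by ring.
by rewrite mul1r mulfK // gt_eqF // rising_gt0 // ltr_wpDr.
Qed.

Let one01 : 0 <= (1 : R) <= 1. Proof. by rewrite ler01 lexx. Qed.

Lemma id_laplace_regenerative :
  regenerative_composition_structure (laplace_cpf (@id R)).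
Proof. exact: (two_parameter_regenerative one01 theta0 ltr01 erefl id_PhiS). Qed.

Lemma id_laplace_generates : generates (laplace_cpf (@id R)) 1 theta.
Proof. exact: (two_parameter_generates one01 theta0 ltr01 erefl id_PhiS). Qed.

Lemma cvg_rising_1B m (F : set_system R) {FF : Filter F} (a : R) :
  F --> a -> rising (1 - alpha) m @[alpha --> F] --> rising (1 - a) m.
Proof.
move=> Fa; elim: m => [|m IHm].
  rewrite rising0; under eq_fun do rewrite rising0.
  exact: cvg_cst.
rewrite risingS; under eq_fun do rewrite risingS.
by apply: cvgM => //; apply: cvgD; [apply: cvgB; [exact: cvg_cst|]|exact: cvg_cst].
Qed.

(** [Phi_beta] itself diverges as alpha tends to 1, so the limit is taken in the closed forms of the
    decrements, where the constant has cancelled and alpha enters polynomially. *)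
Lemma cvg_decrement_1 n m : (0 < m <= n)%N ->
  decrement (Phi_beta alpha theta) n m @[alpha --> (1 : R)^'-] -->
  decrement (@id R) n m.
Proof.
case: m => // m /andP[_ mn].
have cvg1 : (1 : R)^'- --> (1 : R) by exact: cvg_at_left_filter.
have near01 : \forall alpha \near (1 : R)^'-, 0 <= alpha < 1.
  near=> alpha; apply/andP; split; near: alpha; last exact: nbhs_left_lt.
  by apply: nbhs_left_ge.
have le1 (a : R) : 0 <= a < 1 -> 0 <= a <= 1 by case/andP => -> /ltW ->.
have c0 (a : R) : 0 <= a < 1 -> 0 < Beta (1 - a) (1 + theta).
  by move=> /andP[_ a1]; rewrite Beta_gt0 ?subr_gt0 // ltr_wpDr.
have PS (a : R) : 0 <= a < 1 -> forall k, Phi_beta a theta k.+1%:R =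
    Beta (1 - a) (1 + theta) * k.+1%:R * rising (1 + theta) k / rising (theta + 2 - a) k.
  by move=> /andP[_ a1] k; exact: Phi_betaS.
have P0 (a : R) : Phi_beta a theta 0 = 0 by rewrite /Phi_beta mul0r.
rewrite -(subnKC mn); case: (n - _)%N => [|b].
  rewrite addn0 (two_parameter_decrement_full one01 theta0 ltr01 erefl id_PhiS).
  apply: cvg_trans; first apply: near_eq_cvg.
    near=> a; have a01 : 0 <= a < 1 by near: a.
    rewrite (two_parameter_decrement_full (le1 _ a01) theta0 (c0 _ a01) (P0 a)
      (PS _ a01)).
    reflexivity.
  by apply: cvgM; [exact: cvg_rising_1B|exact: cvg_cst].
rewrite (two_parameter_decrement one01 theta0 ltr01 id_PhiS).
apply: cvg_trans; first apply: near_eq_cvg.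
  near=> a; have a01 : 0 <= a < 1 by near: a.
  rewrite (two_parameter_decrement (le1 _ a01) theta0 (c0 _ a01) (PS _ a01)).
  reflexivity.
apply: cvgM; last exact: cvg_cst.
apply: cvgM; last exact: cvg_cst.
apply: cvgM; first by apply: cvgM; [exact: cvg_cst|exact: cvg_rising_1B].
by apply: cvgD; [apply: cvgM => //; exact: cvg_cst|exact: cvg_cst].
Unshelve. all: by end_near. Qed.

Lemma cvg_laplace_cpf_1 n l : is_composition n l ->
  laplace_cpf (Phi_beta alpha theta) l @[alpha --> (1 : R)^'-] -->
  laplace_cpf (@id R) l.
Proof.
elim: l n => [|m l IHl] n.
  move=> _; rewrite laplace_cpf_nil; under eq_fun do rewrite laplace_cpf_nil.
  exact: cvg_cst.
rewrite is_composition_cons => /andP[/andP[m0 _] /IHl cl].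
rewrite laplace_cpf_cons; under eq_fun do rewrite laplace_cpf_cons.
by apply: cvgM => //; apply: cvg_decrement_1; rewrite m0 leq_addr.
Qed.

(** A class with two or more elements brings in a rising factorial of 0, which vanishes; if all
    classes are singletons, the numerator equals the denominator. *)
Lemma two_parameter_law_1 n (P : {set {set 'I_n}}) :
  finset.partition P [set: 'I_n]%SET ->
  two_parameter_law 1 theta P = [forall B in P, #|B| == 1%N]%:R.
Proof.
move=> PT; rewrite /two_parameter_law subrr.
case: forall_inP => [P1|/forall_inP/forall_inPn[B BP B1]]; last first.
  rewrite (bigD1 B) //= /rising.
  have B2 : (1 < #|B|)%N.
    by rewrite ltn_neqAle eq_sym B1 card_gt0 (partition_neq0 PT).
  case: #|B| B2 => [|[|k]] // _.
  by rewrite big_ord_recl addr0 mul0r mul0r mulr0.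
have -> : #|P| = n.
  rewrite -[RHS]card_ord -cardsT (card_partition PT) -sum1_card.
  by apply: eq_bigr => B /P1/eqP.
rewrite [X in _ * X]big1 => [|B /P1/eqP ->]; last by rewrite rising0.
rewrite mulr1 (_ : \prod_(1 <= i < n) _ = rising (1 + theta) n.-1).
  by rewrite divff // gt_eqF // rising_gt0 // ltr_wpDr.
rewrite /rising -(big_mkord xpredT (fun i => 1 + theta + i%:R)) big_add1.
by apply: eq_bigr => i _; rewrite mul1r -natr1; ring.
Qed.

End SingletonLimit.

Theorem theorem8p1 (R : realType) :
  (forall alpha theta : R, 0 <= alpha < 1 -> 0 <= theta ->
     regenerative_composition_structure (laplace_cpf (Phi_beta alpha theta)) /\
     generates (laplace_cpf (Phi_beta alpha theta)) alpha theta) /\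
  (forall theta : R, 0 <= theta ->
     exists p : seq nat -> R,
       (forall n l, (0 < n)%N -> is_composition n l ->
          laplace_cpf (Phi_beta alpha theta) l @[alpha --> (1 : R)^'-] --> p l) /\
       regenerative_composition_structure p /\
       generates p 1 theta /\
       generates_singletons p) /\
  (forall alpha theta : R,
     ~ (0 <= alpha < 1 /\ 0 <= theta) ->
     ~ (alpha = 1 /\ 0 <= theta) ->
     ~ degenerate alpha theta ->
     ~ exists p : seq nat -> R,
         regenerative_composition_structure p /\ generates p alpha theta).
Proof.
split=> [alpha theta /andP[a0 a1] t0|].
  have a01 : 0 <= alpha <= 1 by rewrite a0 ltW.
  have c0 : 0 < Beta (1 - alpha) (1 + theta).
    by rewrite Beta_gt0 ?subr_gt0 // ltr_wpDr.
  have P0 : Phi_beta alpha theta 0 = 0 by rewrite /Phi_beta mul0r.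
  have PS n := Phi_betaS n a1 t0.
  by split; [exact: two_parameter_regenerative PS|exact: two_parameter_generates PS].
split=> [theta t0|alpha theta h1 h2 ndeg [p [p_struct p_gen]]].
  exists (laplace_cpf id); split; first by move=> n l _; exact: cvg_laplace_cpf_1.
  split; first exact: id_laplace_regenerative t0.
  split; first exact: id_laplace_generates.
  by move=> n P n0 PT; rewrite (id_laplace_generates t0) // two_parameter_law_1.
by case: (generated_parameters p_struct p_gen ndeg).
Qed.
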